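(* Let $\overline{\boldsymbol\chi}=(\boldsymbol\chi^{(1)},\dots,\boldsymbol\chi^{(N-1)})\subset\mathbb{T}^n$ be points in Mikhalkin position. Then there is no singular tropical hypersurface $S$ of degree $d$ passing through $\overline{\boldsymbol\chi}$ whose lattice path $P(S,\overline{\boldsymbol\chi})$ is disconnected, i.e. of the form $$P(S,\overline{\boldsymbol\chi})=P(\Delta\cap\mathbb{Z}^{n+1})\setminus\{[\boldsymbol w^{\mathrm{pr}},\boldsymbol w]\}$$ for some $\boldsymbol w\in\Delta\cap\mathbb{Z}^{n+1}$ with immediate predecessor $\boldsymbol w^{\mathrm{pr}}$.
   Context: Let $n\ge 2$, $d\ge 1$, $\Delta=\Delta_d^{(n)}=\{\boldsymbol x\in\mathbb{R}^{n+1}: \boldsymbol x_i\ge 0,\ \sum_{i=0}^n \boldsymbol x_i=d\}$ and $N=|\Delta\cap\mathbb{Z}^{n+1}|-1=\binom{n+d}{n}-1$. $\mathbb{T}^n$ is the quotient of the dual space $(\mathbb{R}^{n+1})^*$ by the span of the functional $\boldsymbol x\mapsto\sum\boldsymbol x_i$; its elements are regarded as linear functionals on $\Delta$ up to an additive constant, with pairing $\langle\cdot,\cdot\rangle$. Tropical hypersurfaces. A tropical polynomial of degree $d$ has coefficients $c_{\boldsymbol v}\in\mathbb{R}\cup\{-\infty\}$ ($\boldsymbol v\in\Delta\cap\mathbb{Z}^{n+1}$); it defines the tropical hypersurface $S\subset\mathbb{T}^n$ which is the non-differentiability locus of $\boldsymbol\psi\mapsto\max_{\boldsymbol v}(\langle\boldsymbol\psi,\boldsymbol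 v\rangle+c_{\boldsymbol v})$. Its Legendre dual is the convex piecewise linear function $\nu:\Delta\to\mathbb{R}$, $\nu(\boldsymbol x)=\min\{-\sum\alpha_{\boldsymbol v}c_{\boldsymbol v}\}$, the minimum over all ways of writing $\boldsymbol x=\sum\alpha_{\boldsymbol v}\boldsymbol v$ as a convex combination of lattice points of $\Delta$. The linearity domains of $\nu$ form the dual subdivision of $\Delta$; its $m$-dimensional cells correspond bijectively to $(n-m)$-dimensional cells of the polyhedral subdivision of $\mathbb{T}^n$ induced by $S$ (edges correspond to $(n-1)$-dimensional faces of $S$). Singular tropical hypersurfaces. Let $\mathbb{K}=\bigcup_{m\ge1}\mathbb{C}((t^{1/m}))$ with its valuation $\mathrm{val}$, and for $\boldsymbol z\in(\mathbb{K}^* )^n\subset\mathbb{P}^n$ let $\mathrm{trop}(\boldsymbol z)=(-\mathrm{val}(\boldsymbol z_0),\dots,-\mathrm{val}(\boldsymbol z_n))\in\mathbb{T}^n$; the tropicalization of a hypersurface is the closure of the image of its points in $(\mathbb{K}^* )^n$. A point $\boldsymbol\psi\in S$ is singular if there is a degree $d$ hypersurface $\mathcal{S}$ over $\mathbb{K}$ tropicalizing to $S$ and a singular point $\boldsymbol q\in\mathcal{S}$ with $\mathrm{trop}(\boldsymbol q)=\boldsymbol\psi$; $S$ is singular if it has a singular point. Order and Mikhalkin position. $\boldsymbol x\prec\boldsymbol y$ iff there is $i$ with $\boldsymbol x_i<\boldsymbol y_i$ and $\boldsymbol x_j=\boldsymbol y_j$ for all $j>i$. Fix a linear functional $\boldsymbol\varphi$,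 rational on $\Delta\cap\mathbb{Z}^{n+1}$, with $\langle\boldsymbol\varphi,\boldsymbol x\rangle<\langle\boldsymbol\varphi,\boldsymbol y\rangle\iff\boldsymbol x\prec\boldsymbol y$ on $\Delta\cap\mathbb{Z}^{n+1}$. The points are in Mikhalkin position if $\boldsymbol\chi^{(i)}=M_i\boldsymbol\varphi$ with positive rationals $M_1\ll M_2\ll\dots\ll M_{N-1}$, where $\ll$ means: for each combination $\sum_{i=1}^k\alpha_iM_i$ with $\alpha_k>0$ from a suitable (sufficiently large) finite set of linear combinations depending only on $n,d,\boldsymbol\varphi$, one has $\sum_{i=1}^k\alpha_iM_i>0$ (i.e. the $M_i$ grow sufficiently fast, generically chosen). For such points every singular tropical hypersurface $S$ through $\overline{\boldsymbol\chi}$ contains each $\boldsymbol\chi^{(i)}$ in the relative interior of an $(n-1)$-dimensional face $F_i$, the $F_i$ being distinct. Lattice paths. $P(S,\overline{\boldsymbol\chi})$ is the set of edges $E_i$ of the dual subdivision dual to the faces $F_i$, $i=1,\dots,N-1$. For $A=\{\boldsymbol v^{(1)}\prec\dots\prec\boldsymbol v^{(m)}\}\subset\Delta\cap\mathbb{Z}^{n+1}$, $P(A)=\{[\boldsymbol v^{(i)},\boldsymbol v^{(i+1)}]: 1\le i\le m-1\}$. *)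

(* Defs.v *)
From HB Require Import structures.
From mathcomp Require Import all_boot all_order all_algebra.
(* The notations of mpoly clash with those of MathComp-Analysis. *)
From mathcomp Require Import -(notations) mpoly.
From mathcomp Require Import all_classical all_reals all_analysis.
From mathcomp Require Import complex.
Set Implicit Arguments.
Unset Strict Implicit.
Unset Printing Implicit Defensive.
Import Order.TTheory GRing.Theory Num.Theory.
Import numFieldNormedType.Exports.
Local Open Scope classical_set_scope.
Local Open Scope ring_scope.

(* Puiseux series over F: functions q |-> (coefficient of t^q) on the rationals
   whose support lies in {j / m | j >= k} for some m > 0 and some integer k. *)
Definition puiseux_support (D : set rat) : Prop :=
  exists (m : nat) (k : int), (0 < m)%N /\
    forall q, D q -> exists j : int, k <= j /\ q = j%:~R / m%:R.

Record puiseux (F : fieldType) := Puiseux {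
  pcoef :> rat -> F;
  pcoefP : puiseux_support [set q | pcoef q != 0] }.

Section PuiseuxRing.
Variable F : fieldType.
Implicit Types (D E : set rat) (f g h : puiseux F) (q : rat).

HB.instance Definition _ := gen_eqMixin (puiseux F).
HB.instance Definition _ := gen_choiceMixin (puiseux F).

Lemma puiseux_eq f g : (forall q, f q = g q) -> f = g.
Proof.
case: f g => [f fP] [g gP] /= /funext fg.
by case: g / fg gP => gP; congr Puiseux; exact: Prop_irrelevance.
Qed.

Lemma puiseux_supportS D E : D `<=` E -> puiseux_support E -> puiseux_support D.
Proof. by move=> DE [m [k [m0 Ek]]]; exists m, k; split=> // q /DE/Ek. Qed.

(* a common denominator and a common lower bound for two supports *)
Lemma puiseux_support2 D E : puiseux_support D -> puiseux_support E ->
  exists (m : nat) (k : int), (0 < m)%N /\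
    forall q, D q \/ E q -> exists j : int, k <= j /\ q = j%:~R / m%:R.
Proof.
move=> [m [k [m0 Dk]]] [p [l [p0 El]]].
have m0' : m%:R != 0 :> rat by rewrite pnatr_eq0 -lt0n.
have p0' : p%:R != 0 :> rat by rewrite pnatr_eq0 -lt0n.
exists (m * p)%N, (Num.min (k * p%:Z) (l * m%:Z)); split; first by rewrite muln_gt0 m0.
move=> q [/Dk|/El] [j [kj ->]].
  exists (j * p%:Z); split; first by rewrite ge_min ler_wpM2r.
  by rewrite natrM rmorphM /= -mulf_div divff // mulr1.
exists (j * m%:Z); split; first by rewrite ge_min [X in _ || X]ler_wpM2r ?orbT.
by rewrite natrM [m%:R * _]mulrC rmorphM /= -mulf_div divff // mulr1.
Qed.

Lemma puiseux_supportD D E : puiseux_support D -> puiseux_support E ->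
  puiseux_support [set q | exists2 a, D a & E (q - a)].
Proof.
move=> DP EP; have [m [k [m0 DEk]]] := puiseux_support2 DP EP.
exists m, (k + k); split=> // q [a Da Eqa].
have [i [ki ai]] := DEk _ (or_introl Da).
have [j [kj qaj]] := DEk _ (or_intror Eqa).
exists (i + j); split; first exact: lerD.
by rewrite rmorphD mulrDl /= -ai -qaj addrC subrK.
Qed.

Lemma puiseux_support_finite D E q : puiseux_support D -> puiseux_support E ->
  finite_set [set a | D a /\ E (q - a)].
Proof.
move=> DP EP; have [m [k [m0 DEk]]] := puiseux_support2 DP EP.
have m0' : m%:R != 0 :> rat by rewrite pnatr_eq0 -lt0n.
pose n := `|(Num.floor (q * m%:R) - k - k)%R|%N.+1.
apply: (@sub_finite_set _ _ ((fun i : nat => (k + i%:Z)%:~R / m%:R : rat) @` `I_n)).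
  move=> a [Da Eqa].
  have [i [ki ai]] := DEk _ (or_introl Da).
  have [j [kj qaj]] := DEk _ (or_intror Eqa).
  have qij : q * m%:R = (i + j)%:~R.
    by rewrite -[q](subrK a) qaj ai -mulrDl divfK // rmorphD addrC.
  exists `|(i - k)%R|%N; last first.
    by rewrite gez0_abs ?subr_ge0 // [k + _]addrC subrK ai.
  rewrite /= /n qij intrKfloor ltnS -lez_nat !gez0_abs ?subr_ge0 //; last first.
    by rewrite lerBrDr lerD.
  by rewrite lerD2r -addrA lerDl subr_ge0.
exact/finite_image/finite_II.
Qed.

Lemma puiseux0_subproof : puiseux_support [set q : rat | (0 : F) != 0].
Proof. by exists 1%N, 0; split=> // q /=; rewrite eqxx. Qed.
Definition puiseux0 := Puiseux puiseux0_subproof.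

Lemma puiseux1_subproof : puiseux_support [set q : rat | (q == 0)%:R != 0 :> F].
Proof.
exists 1%N, 0; split=> // q /=; case: (q =P 0) => [-> _|]; last by rewrite eqxx.
by exists 0; rewrite mul0r.
Qed.
Definition puiseux1 := Puiseux puiseux1_subproof.

Lemma puiseux_opp_subproof f : puiseux_support [set q | - f q != 0].
Proof. by apply: puiseux_supportS (pcoefP f) => q /=; rewrite oppr_eq0. Qed.
Definition puiseux_opp f := Puiseux (puiseux_opp_subproof f).

Lemma puiseux_add_subproof f g : puiseux_support [set q | f q + g q != 0].
Proof.
have [m [k [m0 fgk]]] := puiseux_support2 (pcoefP f) (pcoefP g).
exists m, k; split=> // q /= fgq; apply: fgk.
case: (eqVneq (f q) 0) => /= [f0|]; [right|by left].
by rewrite f0 add0r in fgq.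
Qed.
Definition puiseux_add f g := Puiseux (puiseux_add_subproof f g).

(* Cauchy product: for each q only finitely many terms are nonzero. *)
Definition cauchy (u v : rat -> F) q : F := \sum_(a \in [set: rat]) u a * v (q - a).

Lemma cauchyE (A : set rat) (u v : rat -> F) q :
  (forall a, u a != 0 -> v (q - a) != 0 -> A a) ->
  cauchy u v q = \sum_(a \in A) u a * v (q - a).
Proof.
move=> uvA; apply/esym/fsbig_widen => // a [_ nA] /=; apply: contrapT => /eqP.
by rewrite mulf_eq0 negb_or => /andP[ua va]; exact/nA/uvA.
Qed.

Lemma cauchy_neq0 (u v : rat -> F) q :
  cauchy u v q != 0 -> exists2 a, u a != 0 & v (q - a) != 0.
Proof.
apply: contraNP => uv; apply/eqP/fsbig1 => a _; apply/eqP; rewrite mulf_eq0.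
by apply: contra_notT uv; rewrite negb_or => /andP[]; exists a.
Qed.

Lemma puiseux_mul_subproof f g : puiseux_support [set q | cauchy f g q != 0].
Proof.
apply: puiseux_supportS (puiseux_supportD (pcoefP f) (pcoefP g)) => q /=.
exact: cauchy_neq0.
Qed.
Definition puiseux_mul f g := Puiseux (puiseux_mul_subproof f g).

Lemma puiseux_addA : associative puiseux_add.
Proof. by move=> f g h; apply: puiseux_eq => q /=; rewrite addrA. Qed.
Lemma puiseux_addC : commutative puiseux_add.
Proof. by move=> f g; apply: puiseux_eq => q /=; rewrite addrC. Qed.
Lemma puiseux_add0 : left_id puiseux0 puiseux_add.
Proof. by move=> f; apply: puiseux_eq => q /=; rewrite add0r. Qed.
Lemma puiseux_addN : left_inverse puiseux0 puiseux_opp puiseux_add.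
Proof. by move=> f; apply: puiseux_eq => q /=; rewrite addNr. Qed.

HB.instance Definition _ := GRing.isZmodule.Build (puiseux F)
  puiseux_addA puiseux_addC puiseux_add0 puiseux_addN.

Lemma puiseux_mulC : commutative puiseux_mul.
Proof.
move=> f g; apply: puiseux_eq => q /=; rewrite /cauchy.
rewrite (reindex_fsbigT (fun a => q - a)) /=.
  by apply: eq_fsbigr => a _; rewrite subKr mulrC.
by exists (fun a => q - a) => a; exact: subKr.
Qed.

Lemma puiseux_mul1 : left_id puiseux1 puiseux_mul.
Proof.
move=> f; apply: puiseux_eq => q /=; rewrite (@cauchyE [set 0]).
  by rewrite fsbig_set1 eqxx mul1r subr0.
by move=> a; case: (a =P 0) => //; rewrite eqxx.
Qed.

Lemma puiseux_mulDl : left_distributive puiseux_mul +%R.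
Proof.
move=> f g h; apply: puiseux_eq => q /=.
pose A := [set a | (f a != 0 \/ g a != 0) /\ h (q - a) != 0].
rewrite (@cauchyE A _ _ q); last first.
  move=> a fga ha; split=> //=.
  case: (eqVneq (f a) 0) fga => [->|]; [by rewrite add0r; right|by left].
rewrite (@cauchyE A f); last by move=> a fa ha; split=> //; left.
rewrite (@cauchyE A g); last by move=> a ga ha; split=> //; right.
rewrite -fsbig_split /=; first by apply: eq_fsbigr => a _; rewrite mulrDl.
apply: puiseux_support_finite (pcoefP h).
exact: puiseux_support2 (pcoefP f) (pcoefP g).
Qed.

Lemma puiseux_mulA : associative puiseux_mul.
Proof.
move=> f g h; apply: puiseux_eq => q /=.
pose A := [set a | f a != 0 /\ exists2 b, g b != 0 & h (q - a - b) != 0].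
pose C := [set c | (exists2 a, f a != 0 & g (c - a) != 0) /\ h (q - c) != 0].
have fA : finite_set A.
  exact: puiseux_support_finite (pcoefP f) (puiseux_supportD (pcoefP g) (pcoefP h)).
have fC : finite_set C.
  exact: puiseux_support_finite (puiseux_supportD (pcoefP f) (pcoefP g)) (pcoefP h).
rewrite (@cauchyE A); last by move=> a fa /cauchy_neq0 [b gb hb]; split=> //; exists b.
rewrite (@cauchyE C); last by move=> c /cauchy_neq0 [a fa ga] hc; split=> //; exists a.
transitivity (\sum_(a \in A) \sum_(c \in C) f a * (g (c - a) * h (q - c))).
  apply: eq_fsbigr => a /set_mem [fa _].
  rewrite -mulr_fsumr; congr (_ * _).
  rewrite /cauchy (reindex_fsbigT (fun c => c - a)) /=; last first.
    by exists (fun c => c + a) => c; rewrite ?subrK ?addrK.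
  under eq_fsbigr => c _ do rewrite opprB addrA subrK.
  apply/esym/fsbig_widen => // c [_ nC] /=; apply: contrapT => /eqP.
  by rewrite mulf_eq0 negb_or => /andP[gc hc]; apply: nC; split=> //; exists a.
rewrite exchange_fsbig //; apply: eq_fsbigr => c /set_mem [_ hc].
rewrite (@cauchyE A); last first.
  move=> a fa ga; split=> //; exists (c - a) => //.
  by rewrite opprB addrA subrK.
by rewrite mulr_fsuml; apply: eq_fsbigr => a _; rewrite mulrA.
Qed.

Lemma puiseux1_neq0 : puiseux1 != 0.
Proof.
apply/eqP => /(congr1 (fun f : puiseux F => f 0)) /= /eqP.
by rewrite oner_eq0.
Qed.

HB.instance Definition _ := GRing.Zmodule_isComNzRing.Build (puiseux F)
  puiseux_mulA puiseux_mulC puiseux_mul1 puiseux_mulDl puiseux1_neq0.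

End PuiseuxRing.

(* The least exponent of z; the default value 0 is only used for z = 0. *)
Definition valuation (F : fieldType) (z : puiseux F) : rat :=
  xget 0 [set q | z q != 0 /\ forall r, r < q -> z r = 0].

Section ConvexGeometry.
Variables (R : realType) (k : nat).
Implicit Types (A : set 'rV[R]_k) (x : 'rV[R]_k).

Definition segment (x y : 'rV[R]_k) : set 'rV[R]_k :=
  [set z | exists t : R, 0 <= t <= 1 /\ z = (1 - t) *: x + t *: y].

Definition affine_hull A : set 'rV[R]_k :=
  [set x | exists (m : nat) (p : 'I_m -> 'rV[R]_k) (a : 'I_m -> R),
     [/\ forall i, A (p i), \sum_i a i = 1 & x = \sum_i a i *: p i]].

Definition affinely_free (m : nat) (p : 'I_m.+1 -> 'rV[R]_k) : Prop :=
  row_free (\matrix_(i < m) (p (lift ord0 i) - p ord0)).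

Definition affine_dim A (m : nat) : Prop :=
  (exists p : 'I_m.+1 -> 'rV[R]_k, (forall i, A (p i)) /\ affinely_free p) /\
  ~ (exists p : 'I_m.+2 -> 'rV[R]_k, (forall i, A (p i)) /\ affinely_free p).

Definition relint A : set 'rV[R]_k :=
  [set x | A x /\ \forall y \near x, affine_hull A y -> A y].

Definition pairing (psi x : 'rV[R]_k) : R := \sum_i psi 0 i * x 0 i.

End ConvexGeometry.

Section LatticePoints.
Variables n d : nat.

Definition lattice_pt :=
  {v : {ffun 'I_n.+1 -> 'I_d.+1} | (\sum_i v i == d)%N}.

Definition coord (v : lattice_pt) (i : 'I_n.+1) : nat := sval v i.

Definition prec (v w : lattice_pt) : Prop :=
  exists i, (coord v i < coord w i)%N /\
    forall j : 'I_n.+1, (i < j)%N -> coord v j = coord w j.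

Definition consecutive (A : set lattice_pt) (v w : lattice_pt) : Prop :=
  [/\ A v, A w, prec v w & forall u, A u -> ~ (prec v u /\ prec u w)].

Definition hypersurface_dim : nat := #|{: lattice_pt}|.-1.

End LatticePoints.

Section Tropical.
Variables (R : realType) (n d : nat).
(* Points of T^n are represented by functionals in R^(n+1), modulo the constant
   vectors; subsets of T^n by translation-invariant subsets of R^(n+1), so that
   dimensions in T^n are one less than dimensions in R^(n+1). *)
Local Notation V := 'rV[R]_n.+1.
Local Notation L := (lattice_pt n d).
Local Notation K := (puiseux R[i]).
Implicit Types (psi x : V) (c : L -> \bar R).

Definition same_point psi psi' : Prop := exists a : R, psi' = psi + const_mx a.

Definition pt (v : L) : V := \row_i (coord v i)%:R.

Definition Delta : set V :=
  [set x | (forall i, 0 <= x 0 i) /\ \sum_i x 0 i = d%:R].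

Definition path_of (A : set L) : set (set V) :=
  [set E | exists v w, consecutive A v w /\ E = segment (pt v) (pt w)].

Definition tropical_polynomial c : Prop := forall v, c v != +oo%E.

Definition trop_eval c psi : \bar R :=
  \big[maxe/-oo%E]_(v : L) (c v + (pairing psi (pt v))%:E)%E.

Definition trop_fun c psi : R := fine (trop_eval c psi).

Definition hypersurface c : set V := [set psi | ~ differentiable (trop_fun c) psi].

(* The product 0 * -oo is 0, so a weight zero on an absent monomial is harmless;
   legendre c is +oo at the points that admit no combination of the monomials
   with finite coefficients. *)
Definition legendre c x : \bar R :=
  ereal_inf [set (- \sum_(v : L) (alpha v)%:E * c v)%E | alpha in
    [set alpha : L -> R | [/\ forall v, 0 <= alpha v, \sum_v alpha v = 1
                            & x = \sum_v alpha v *: pt v]]].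

(* The linearity domains of the convex function legendre c, and their faces:
   nonempty contact sets with the affine functions lying below it. *)
Definition dual_subdivision c : set (set V) :=
  [set D | D !=set0 /\ exists psi (b : R),
    (forall x, Delta x -> ((pairing psi x + b)%:E <= legendre c x)%E) /\
    D = [set x | Delta x /\ legendre c x = (pairing psi x + b)%:E]].

Definition maximizers c psi : set L :=
  [set v | (c v + (pairing psi (pt v))%:E)%E = trop_eval c psi].

(* The cells of the polyhedral subdivision of T^n induced by the hypersurface. *)
Definition trop_cells c : set (set V) :=
  [set C | exists psi0, C = [set psi | maximizers c psi0 `<=` maximizers c psi]].

Definition trop_dim (C : set V) (m : nat) : Prop := affine_dim C m.+1.

(* Legendre duality of cells, by equality in the Fenchel inequality
   pairing psi x <= trop_fun c psi + legendre c x. *)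
Definition dual_cell c (C : set V) : set V :=
  [set x | Delta x /\
    forall psi, C psi -> legendre c x = (pairing psi x - trop_fun c psi)%:E].

(* P(S, chi) for the hypersurface S of c. *)
Definition dual_path c (I : Type) (chi : I -> V) : set (set V) :=
  [set E | [/\ dual_subdivision c E, affine_dim E 1 &
    exists i C, [/\ trop_cells c C, C `<=` hypersurface c, trop_dim C n.-1,
                    relint C (chi i) & E = dual_cell c C]]].

Definition trop (z : 'I_n.+1 -> K) : V := \row_i - ratr (valuation (z i)).

Definition in_torus (z : 'I_n.+1 -> K) : Prop := forall i, z i != 0.

Definition is_form (F : mpoly n.+1 K) : Prop :=
  F != 0 /\ F \is ishomog1 d mdeg.

Definition tropicalization (F : mpoly n.+1 K) : set V :=
  closure [set psi | exists z, [/\ in_torus z, meval z F = 0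
                                 & same_point (trop z) psi]].

Definition singular_zero (F : mpoly n.+1 K) (q : 'I_n.+1 -> K) : Prop :=
  meval q F = 0 /\ forall i, meval q (mderiv i F) = 0.

Definition singular_point c psi : Prop :=
  hypersurface c psi /\
  exists F, [/\ is_form F, tropicalization F = hypersurface c &
    exists q, [/\ in_torus q, singular_zero F q & same_point (trop q) psi]].

Definition singular_hypersurface c : Prop := exists psi, singular_point c psi.

Definition order_functional (phi : V) : Prop :=
  (forall v : L, exists r : rat, pairing phi (pt v) = ratr r) /\
  (forall v w : L, pairing phi (pt v) < pairing phi (pt w) <-> prec v w).

End Tropical.

(* M_1 << M_2 << ... relative to the finite list Lam of linear combinations. *)
Definition fast_growing (m : nat) (Lam : seq {ffun 'I_m -> rat})
    (M : 'I_m -> rat) : Prop :=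
  forall alpha k, alpha \in Lam -> 0 < alpha k ->
    (forall j : 'I_m, (k < j)%N -> alpha j = 0) -> 0 < \sum_i alpha i * M i.

Definition mikhalkin_position (R : realType) (n m : nat)
    (Lam : seq {ffun 'I_m -> rat}) (phi : 'rV[R]_n.+1)
    (chi : 'I_m -> 'rV[R]_n.+1) : Prop :=
  exists M : 'I_m -> rat, [/\ forall i, 0 < M i, fast_growing Lam M &
    forall i, same_point (ratr (M i) *: phi) (chi i)].

(* Main.v *)
(* Along the line spanned by phi the functional order makes every lattice point
   of a full or disconnected path a vertex: reading breakpoints from left to
   right, N of them on N + 1 monomials leave no choice, and if the gap carries no
   breakpoint then an end point of the path is a missing corner of the Newton
   polytope. Hence the coefficients are a strictly concave function of
   <phi, v>, so that x + y = u + t with u < x < t forbids u and t to be maximal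
   together. This exchange property alone forces the maximal monomials at any
   point to be affinely independent: the values of the last coordinate are
   consecutive, and two layers share at most one other coordinate. A singular
   point would give an affine dependency among them, namely its coefficients of
   least order in t. *)
Require Import Defs.
From mathcomp Require Import all_boot all_order all_algebra.
From mathcomp Require Import zify ring lra.
From mathcomp Require Import -(notations) mpoly.
From mathcomp Require Import all_classical all_reals all_analysis complex.
Import Order.TTheory GRing.Theory Num.Theory.
Import numFieldNormedType.Exports.
Set Implicit Arguments.
Unset Strict Implicit.
Unset Printing Implicit Defensive.
Local Open Scope classical_set_scope.
Local Open Scope ring_scope.
Local Notation coord := Defs.coord.

(** The polynomial [c] and the form [P] lifting its hypersurface are linked only by an equality of
    sets: their coefficients are not known to agree, nor are their supports. The path speaks about
    [c], whereas the dependency at a singular point is among monomials of [P]. What can be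
    transported is a chain of inclusions: points with two maximal monomials of [c] lie in
    [hypersurface c], which is [tropicalization P], whose points have two maximal monomials of [P].
    The breakpoints of [P] are therefore recovered by counting, and the count closes only if [P] has
    no monomial outside the window that the breakpoints span; this is why a corner missing in [c]
    must be shown to be missing in [P]. The singular point need not lie on the line. Concavity in
    <phi, v> is a statement about coefficients alone, and x + y = u + t cancels the linear terms at
    any other point. *)

Section LatticePointTheory.
Variables n d : nat.
Local Notation L := (lattice_pt n d).
Implicit Types u v w x y t : L.

Lemma sum_coord v : (\sum_i coord v i = d)%N.
Proof. by rewrite /coord; case: v => v /= /eqP. Qed.

Lemma coord_inj v w : (forall i, coord v i = coord w i) -> v = w.
Proof. by move=> vw; apply/val_inj/ffunP => i; apply: val_inj; exact: vw. Qed.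

Lemma lattice_ptP (f : 'I_n.+1 -> nat) : (\sum_i f i = d)%N ->
  exists v, forall i, coord v i = f i.
Proof.
move=> fd; have fl i : (f i < d.+1)%N by rewrite ltnS -fd (bigD1 i) //= leq_addr.
pose g := [ffun i => Ordinal (fl i)].
have gd : (\sum_i g i == d)%N.
  by apply/eqP; rewrite -[RHS]fd; apply: eq_bigr => i _; rewrite ffunE.
by exists (exist _ g gd) => i; rewrite /coord /= ffunE.
Qed.

(** Here [x] is [u + e_i - e_j]; adding on both sides avoids truncated subtraction. *)
Lemma exchange_pt u i j : i != j -> (0 < coord u j)%N ->
  exists x, forall k, (coord x k + (k == j) = coord u k + (k == i))%N.
Proof.
move=> ij uj; pose f k := (coord u k + (k == i) - (k == j))%N.
have fE k : (f k + (k == j) = coord u k + (k == i))%N.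
  by rewrite /f; case: (eqVneq k j) => [->|]; rewrite /= ?subn0 ?addn0 //; lia.
have sum_delta l : (\sum_(k < n.+1) (k == l) = 1)%N.
  by rewrite (bigD1 l) //= eqxx big1 ?addn0 // => k /negPf ->.
have [|x xE] := lattice_ptP (f := f); last by exists x => k; rewrite xE fE.
apply/eqP; rewrite -(eqn_add2r 1) -{1}(sum_delta j) -big_split /=.
by rewrite (eq_bigr _ (fun k _ => fE k)) big_split /= sum_delta sum_coord.
Qed.

(** The points [x] and [y] range over all lattice points, members of [W] or not. Since [prec] is
    invariant under translation, [y] also lies strictly between [u] and [t]. *)
Definition exchange_free (W : set L) : Prop := forall u t x y, W u -> W t ->
  (forall i, (coord x i + coord y i = coord u i + coord t i)%N) ->
  prec u x -> prec x t -> False.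

(** * Affine independence of exchange-free sets *)

Section Independence.
Variables (F : numDomainType) (W : set L).
Hypothesis Wfree : exchange_free W.

(** The exchanged pair is [u + e_i - e_j] and [t - e_i + e_j]; the positivity conditions keep it in
    the simplex, so only the order remains to be checked. *)
Lemma exchange_step u t i j : W u -> W t -> i != j ->
  (0 < coord u j)%N -> (0 < coord t i)%N ->
  (forall x, (forall k, (coord x k + (k == j) = coord u k + (k == i))%N) ->
    prec u x /\ prec x t) -> False.
Proof.
move=> Wu Wt ij uj ti H.
have [x xE] := exchange_pt ij uj; have ji : j != i by rewrite eq_sym.
have [y yE] := exchange_pt ji ti.
have [ux xt] := H x xE; apply: (@Wfree u t x y Wu Wt _ ux xt) => k.
by move: (xE k) (yE k); lia.
Qed.

(* Coordinates of index at least [m] are constant on the support of [beta]; the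
   next one takes two consecutive values, and the supports of the two layers
   meet in at most one of the remaining coordinates, so that a relation splits
   into relations on the two layers. *)
Lemma exchange_free_indep_rec m (beta : L -> F) (cst : 'I_n.+1 -> nat) :
  (forall v, beta v != 0 -> W v) ->
  (forall v, beta v != 0 -> forall j : 'I_n.+1, (m <= j)%N -> coord v j = cst j) ->
  \sum_v beta v = 0 ->
  (forall i, \sum_v beta v * (coord v i)%:R = 0) ->
  forall v, beta v = 0.
Proof.
elim: m beta cst => [|m IH] beta cst bW bc b0 bi v.
  apply/eqP/negPn/negP => bv; move: b0; rewrite (bigD1 v) //= big1 ?addr0.
    by move/eqP; rewrite (negPf bv).
  move=> u uv; apply: contraNeq uv => bu; apply/eqP/coord_inj => i.
  by rewrite (bc v) // (bc u).
have [mn|nm] := ltnP m n.+1; last first.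
  by apply: (IH beta cst) => // u _ j /(leq_trans nm); rewrite leqNgt ltn_ord.
have [supp0|/existsP[t0 bt0]] := boolP [forall u, beta u == 0].
  exact/eqP/(forallP supp0).
have {}bt0 : [pred u | beta u != 0] t0 by [].
pose im := Ordinal mn.
case: (arg_maxnP (fun u => coord u im) bt0) => t /= bt tmax.
set z := coord t im in tmax.
(* The value is [z] or [z - 1], in a form that can be weighted by [beta] and summed. If it were at
   most [z - 2], some coordinate [j < im] of [u] would exceed that of [t], as the totals agree, and
   moving a unit of [u] from [j] to [im] would land strictly between [u] and [t]. *)
have layers u : beta u != 0 -> (coord u im + 1 = z + (coord u im == z))%N.
  move=> bu; have := tmax u bu; rewrite -/z leq_eqVlt => /orP[/eqP ->|uz].
    by rewrite eqxx.
  suff : ~ (coord u im + 2 <= z)%N by move=> ?; case: eqP; lia.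
  move=> uz2; have [j jtu] : exists j, (coord t j < coord u j)%N.
    apply/existsP; apply: contraT; rewrite negb_exists => /forallP tu.
    have : (\sum_i coord u i = \sum_i coord t i)%N by rewrite !sum_coord.
    rewrite (bigD1 im) //= [RHS](bigD1 im) //= -/z.
    have : (\sum_(i < n.+1 | i != im) coord u i <= \sum_(i < n.+1 | i != im) coord t i)%N.
      by apply: leq_sum => i _; rewrite leqNgt.
    move=> le e; move: uz; rewrite -(ltn_add2r (\sum_(i < n.+1 | i != im) coord t i)) -e.
    by rewrite ltn_add2l ltnNge le.
  have jim : (j < im)%N.
    rewrite ltnNge leq_eqVlt; apply/negP => /orP[/eqP/val_inj jE|imj].
      by move: jtu uz; rewrite -jE -/z; lia.
    by move: jtu; rewrite (bc t) ?(bc u) ?ltnn.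
  have imj : im != j by apply: contraTneq jim => ->; rewrite ltnn.
  apply: (exchange_step (bW _ bu) (bW _ bt) imj) => [||x xE]; rewrite -/z.
  - by case: (coord u j) jtu.
  - by lia.
  split; exists im; (split; first by move: (xE im);
    rewrite eqxx (negPf imj) -/z; lia) => k imk.
    have := xE k; have [kj|_] := eqVneq k j; first by rewrite kj in imk; lia.
    by have [kj|_] := eqVneq k im; [rewrite kj ltnn in imk|lia].
  have := xE k; have [kj|_] := eqVneq k j; first by rewrite kj in imk; lia.
  have [kj|_] := eqVneq k im; first by rewrite kj ltnn in imk.
  by rewrite (bc t) // (bc u) //; lia.
(* Moving a unit of [u] from [j] up to [i] increases [u] but leaves it in the lower layer, hence
   below [w]. So the indices below [m] used in the top layer never exceed those used in the lower
   one. *)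
have cross u w (i j : 'I_n.+1) : beta u != 0 -> coord u im != z ->
    beta w != 0 -> coord w im = z -> (j < i)%N -> (i < m)%N ->
    (0 < coord u j)%N -> (0 < coord w i)%N -> False.
  move=> bu uz bw wz ji ilm uj wi.
  have ij : i != j by apply: contraTneq ji => ->; rewrite ltnn.
  apply: (exchange_step (bW _ bu) (bW _ bw) ij uj wi) => x xE; split.
    exists i; split; first by move: (xE i); rewrite eqxx (negPf ij); lia.
    move=> k ik; have := xE k; have [kj|_] := eqVneq k j.
      by rewrite kj in ik; lia.
    by have [kj|_] := eqVneq k i; [rewrite kj ltnn in ik|lia].
  have out (k : 'I_n.+1) : (m <= k)%N -> coord x k = coord u k.
    move=> mk; have := xE k.
    have [kj|_] := eqVneq k j; first by rewrite kj in mk; lia.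
    by have [kj|_] := eqVneq k i; [rewrite kj in mk; lia|lia].
  exists im; split.
    by have := layers u bu; rewrite (negPf uz) (out im (leqnn m)) wz; lia.
  by move=> k imk; rewrite out ?(bc u) ?(bc w) // ltnW.
pose bz u := if coord u im == z then beta u else 0.
(* Weighting [layers] by [beta] and summing kills all terms but those of [bz]. *)
have bz_sum0 : \sum_u bz u = 0.
  have : \sum_u (beta u * (coord u im)%:R + beta u) = \sum_u (beta u * z%:R + bz u).
    apply: eq_bigr => u _; have [bu|bu] := eqVneq (beta u) 0.
      by rewrite /bz bu !mul0r !add0r if_same.
    rewrite -[X in _ + X = _]mulr1 -mulrDr -[1]/(1%:R) -natrD layers // natrD mulrDr.
    by rewrite /bz; case: ifP; rewrite ?mulr1 ?mulr0.
  by rewrite !big_split /= bi b0 -mulr_suml b0 mul0r !add0r => <-.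
have bz_const (f : nat) i :
    (forall u, bz u != 0 -> coord u i = f) -> \sum_u bz u * (coord u i)%:R = 0.
  move=> uf; rewrite (eq_bigr (fun u => bz u * f%:R)) => [|u _].
    by rewrite -mulr_suml bz_sum0 mul0r.
  by have [->|/uf ->] := eqVneq (bz u) 0; rewrite ?mul0r.
have bzP u : bz u != 0 -> coord u im = z /\ beta u != 0.
  by rewrite /bz; case: (coord u im =P z) => [-> | _]; rewrite ?eqxx.
have bz_out (i : 'I_n.+1) : (m <= i)%N -> \sum_u bz u * (coord u i)%:R = 0.
  rewrite leq_eqVlt => /orP[/eqP mi|mi].
    have -> : i = im by apply: val_inj.
    by apply: (bz_const z) => u /bzP[].
  by apply: (bz_const (cst i)) => u /bzP[_ bu]; exact: bc.
have bz_low i : (forall u, beta u != 0 -> coord u im != z -> coord u i = 0%N) ->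
    \sum_u bz u * (coord u i)%:R = 0.
  move=> ui; rewrite -[RHS](bi i); apply: eq_bigr => u _; rewrite /bz.
  case: ifPn => // uz; have [->|bu] := eqVneq (beta u) 0; first by [].
  by rewrite ui // !mulr0n !mulr0.
(* If the top layer uses an index between [i] and [m], the lower layer avoids [i]; if the lower
   layer uses an index below [i], the top layer avoids [i]. Otherwise the relation holds for every
   other index, and the constant coordinate sum [d] yields it for [i]. *)
have bz_i i : \sum_u bz u * (coord u i)%:R = 0.
  have [|im'] := leqP m i; first exact: bz_out.
  have [/existsP[w /existsP[k /and4P[bw ik km wk]]]|noW] := boolP
      [exists w, exists k : 'I_n.+1, [&& bz w != 0, (i < k)%N, (k < m)%N & (0 < coord w k)%N]].
    have [wz {}bw] := bzP _ bw.
    apply: bz_low => u bu uz; apply/eqP; rewrite -leqn0 leqNgt; apply/negP => ui.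
    exact: cross bu uz bw wz ik km ui wk.
  have [/existsP[u /existsP[j /and4P[bu uz ji uj]]]|noU] := boolP
      [exists u, exists j : 'I_n.+1,
        [&& beta u != 0, coord u im != z, (j < i)%N & (0 < coord u j)%N]].
    apply: (bz_const 0%N) => w /bzP[wz bw].
    apply/eqP; rewrite -leqn0 leqNgt; apply/negP => wi.
    exact: cross bu uz bw wz ji im' uj wi.
  have tot : \sum_j \sum_u bz u * (coord u j)%:R = 0.
    rewrite exchange_big /= (eq_bigr (fun u => bz u * d%:R)).
      by rewrite -mulr_suml bz_sum0 mul0r.
    by move=> u _; rewrite -mulr_sumr -natr_sum sum_coord.
  move: tot; rewrite (bigD1 i) //= [X in _ + X]big1 ?addr0 // => j ji.
  have [|jm] := leqP m j; first exact: bz_out.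
  have [ij|ij|ij] := ltngtP i j; last by case/eqP: ji; exact: val_inj.
    apply: (bz_const 0%N) => w bw.
    apply/eqP; rewrite -leqn0 leqNgt; apply/negP => wj.
    by case/existsP: noW; exists w; apply/existsP; exists j; rewrite bw ij jm wj.
  apply: bz_low => u bu uz; apply/eqP; rewrite -leqn0 leqNgt; apply/negP => uj.
  by case/existsP: noU; exists u; apply/existsP; exists j; rewrite bu uz ij uj.
(* On the support of [bz] coordinate [im] is constantly [z]; once [bz] vanishes, it is constantly
   [z - 1] on that of [beta]. The induction hypothesis thus applies twice. *)
have bz0 u : bz u = 0.
  apply: (IH bz (fun j => if j == im then z else cst j)) => // w /bzP[wz bw].
    exact: bW.
  move=> j; case: eqP => [->|jim] // mj; apply: bc => //.
  by rewrite ltn_neqAle mj andbT; apply/eqP => mj'; exact/jim/val_inj.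
have bnz u : beta u != 0 -> coord u im != z.
  by move=> bu; apply: contraNneq bu => uz; rewrite -(bz0 u) /bz uz eqxx.
apply: (IH beta (fun j => if j == im then z.-1 else cst j)) => // w bw j.
case: eqP => [->|jim] mj; last first.
  by apply: bc => //; rewrite ltn_neqAle mj andbT; apply/eqP => mj'; exact/jim/val_inj.
by have := layers w bw; rewrite (negPf (bnz w bw)); lia.
Qed.

(** Euler's relation: the coordinates of a lattice point add up to [d], so for [d > 0] the
    coordinate relations force [beta] to sum to zero. *)
Lemma exchange_free_indep (beta : L -> F) : (0 < d)%N ->
  (forall v, beta v != 0 -> W v) ->
  (forall i, \sum_v beta v * (coord v i)%:R = 0) -> forall v, beta v = 0.
Proof.
move=> d0 bW bi; apply: (@exchange_free_indep_rec n.+1 _ (fun=> 0%N)) => //.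
  by move=> v _ j; rewrite leqNgt ltn_ord.
have : \sum_i \sum_v beta v * (coord v i)%:R = 0 by rewrite big1.
rewrite exchange_big (eq_bigr (fun v => beta v * d%:R)) /=.
  by rewrite -mulr_suml => /eqP; rewrite mulf_eq0 pnatr_eq0 -[d == _]negbK -lt0n d0 orbF => /eqP.
by move=> v _; rewrite -mulr_sumr -natr_sum sum_coord.
Qed.

End Independence.
End LatticePointTheory.

(** * Valuations and leading coefficients of Puiseux series *)

Section PuiseuxValuation.
Variable F : fieldType.
Local Notation K := (puiseux F).
Implicit Types (f g : K) (q r : rat) (a b : F).

(* The coefficient [a] is allowed to vanish. *)
Definition leads f q a : Prop := f q = a /\ forall r, r < q -> f r = 0.

Lemma puiseux_valuationP f : f != 0 ->
  f (valuation f) != 0 /\ forall r, r < valuation f -> f r = 0.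
Proof.
move=> f0; suff [q fq] : exists q, [set q | f q != 0 /\ forall r, r < q -> f r = 0] q.
  by have := xgetPex 0 (ex_intro _ q fq).
have [q fq] : exists q, f q != 0.
  apply: contrapT => nf; case/eqP: f0; apply: puiseux_eq => q.
  by apply/eqP/negPn/negP => fq; apply: nf; exists q.
have [m [k [m0 mk]]] := pcoefP f.
(* Exponents bounded below with a common denominator are indexed by natural numbers, so a least one
   exists. *)
have supp r : f r != 0 -> exists i : nat, r = (k + i%:Z)%:~R / m%:R.
  move=> /mk [j [kj ->]]; exists `|(j - k)%R|%N.
  by rewrite gez0_abs ?subr_ge0 // [k + _]addrC subrK.
have [i qi] := supp q fq; rewrite qi in fq.
have exP : exists i : nat, f ((k + i%:Z)%:~R / m%:R) != 0 by exists i.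
case: (ex_minnP exP) => l fl lmin; exists ((k + l%:Z)%:~R / m%:R); split=> // r rl.
apply/eqP/negPn/negP => fr; have [p rp] := supp r fr; rewrite rp in fr rl.
have := lmin p fr; rewrite leqNgt => /negP; apply; move: rl.
by rewrite ltr_pM2r ?invr_gt0 ?ltr0n // ltr_int ltrD2l.
Qed.

(** The zero series is covered with coefficient 0, whatever its default valuation. *)
Lemma leads_valuation f : leads f (valuation f) (f (valuation f)).
Proof.
split=> //; have [->|/puiseux_valuationP[]] := eqVneq f 0; first by [].
by [].
Qed.

Lemma leads1 : leads 1 0 1.
Proof. by split=> //= r r0; rewrite lt_eqF. Qed.

Lemma leadsM f g q r a b :
  leads f q a -> leads g r b -> leads (f * g) (q + r) (a * b).
Proof.
move=> [fq f0] [gr g0]; split=> [|s sqr].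
  rewrite /= (@cauchyE _ [set q]); first by rewrite fsbig_set1 addrAC subrr add0r fq gr.
  move=> p fp gp; apply/eqP; rewrite eq_le !leNgt; apply/andP; split; apply/negP => pq.
    by case/eqP: gp; apply: g0; lra.
  by case/eqP: fp; exact: f0.
apply/eqP/negPn/negP => /cauchy_neq0[p fp gp].
have [pq|qp] := ltP p q; first by case/eqP: fp; exact: f0.
by case/eqP: gp; apply: g0; lra.
Qed.

Lemma leadsX f q a k : leads f q a -> leads (f ^+ k) (q *+ k) (a ^+ k).
Proof.
move=> fq; elim: k => [|k IH]; first by rewrite !expr0 mulr0n; exact: leads1.
by rewrite !exprS mulrS; exact: leadsM.
Qed.

Lemma leads_prod (I : finType) (f : I -> K) (q : I -> rat) (a : I -> F) :
  (forall i, leads (f i) (q i) (a i)) ->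
  leads (\prod_i f i) (\sum_i q i) (\prod_i a i).
Proof.
move=> fqa.
by elim/big_rec3: _ => [|i x y z _]; [exact: leads1|exact: leadsM].
Qed.

Lemma pcoef_sum (I : finType) (f : I -> K) q : (\sum_i f i) q = \sum_i f i q.
Proof. by elim/big_rec2: _ => // i x y _ <-. Qed.

Lemma pcoefMn f k q : (f *+ k) q = f q *+ k.
Proof. by elim: k => // k IH; rewrite !mulrS -IH. Qed.

End PuiseuxValuation.

(** * Forms as sums over lattice points *)

Section Forms.
Variables (n d : nat) (K : comNzRingType).
Local Notation L := (lattice_pt n d).

Definition monomial_of (v : L) : multinom n.+1 := Multinom [tuple coord v i | i < n.+1].

Lemma monomial_ofE v i : monomial_of v i = coord v i.
Proof. by rewrite mnmE. Qed.

Definition form_coef (P : mpoly n.+1 K) (v : L) : K := mcoeff (monomial_of v) P.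

Lemma form_expand (P : mpoly n.+1 K) : P \is ishomog1 d mdeg ->
  P = \sum_(v : L) form_coef P v *: mpolyX K (monomial_of v).
Proof.
move=> Ph; apply/mpolyP => m; rewrite raddf_sum /=.
under eq_bigr => v _ do rewrite mcoeffZ mcoeffX.
have [md|md] := eqVneq (mdeg m) d; last first.
  rewrite (dhomog_nemf_coeff Ph md) big1 // => v _; case: eqP => [vm|]; last by rewrite mulr0.
  case/eqP: md; rewrite -vm mdegE -[RHS](sum_coord v).
  by apply: eq_bigr => i _; rewrite monomial_ofE.
have [|v vm] := lattice_ptP (f := m) (d := d); first by rewrite -mdegE.
have vE : monomial_of v = m by apply/mnmP => i; rewrite monomial_ofE vm.
rewrite (bigD1 v) //= vE eqxx mulr1 big1 ?addr0 /form_coef ?vE // => u uv.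
case: eqP => [um|]; last by rewrite mulr0.
by case/eqP: uv; apply: coord_inj => i; rewrite -!monomial_ofE um vE.
Qed.

Definition form_term (P : mpoly n.+1 K) (z : 'I_n.+1 -> K) (v : L) : K :=
  form_coef P v * \prod_i z i ^+ coord v i.

Lemma meval_form (P : mpoly n.+1 K) z : P \is ishomog1 d mdeg ->
  meval z P = \sum_v form_term P z v.
Proof.
move=> /form_expand {1}->; rewrite raddf_sum /=; apply: eq_bigr => v _.
by rewrite mevalZ mevalX; congr (_ * _); apply: eq_bigr => i _; rewrite monomial_ofE.
Qed.

(** Multiplying the derivative by [z i] restores each monomial, weighted by its exponent.
    Singularity thus becomes a family of linear relations among the same terms. *)
Lemma meval_mderiv_form (P : mpoly n.+1 K) z i : P \is ishomog1 d mdeg ->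
  z i * meval z (mderiv i P) = \sum_v form_term P z v *+ coord v i.
Proof.
move=> Ph; have -> : mderiv i P = \sum_v mderiv i (form_coef P v *: mpolyX K (monomial_of v)).
  by rewrite -raddf_sum -form_expand.
rewrite raddf_sum /= mulr_sumr; apply: eq_bigr => v _.
rewrite mderivZ mderivX mevalZ mevalZ mevalX monomial_ofE /form_term.
case vi: (coord v i) => [|k]; first by rewrite mul0r !mulr0.
rewrite -[RHS]mulr_natl (bigD1 i) //= [in RHS](bigD1 i) //= vi.
rewrite mnmBE monomial_ofE vi mnm1E eqxx subn1 /= exprS.
rewrite (eq_bigr (fun j => z j ^+ coord v j)) => [|j ji]; first by ring.
by rewrite mnmBE monomial_ofE mnm1E eq_sym (negPf ji) subn0.
Qed.

End Forms.

(** * Maximal monomials and tropicalization *)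

Section TropicalMaxima.
Variables (R : realType) (n d : nat).
Local Notation V := 'rV[R]_n.+1.
Local Notation L := (lattice_pt n d).
Local Notation K := (puiseux R[i]).
Implicit Types (A : pred L) (g : L -> R) (psi : V) (v u : L).

(* [A] is the support of a tropical polynomial; [g] only matters on it. *)
Definition maximal A g psi v : Prop :=
  A v /\ forall u, A u -> g u + pairing psi (pt R u) <= g v + pairing psi (pt R v).

(** The corner locus of the maximum, free of derivatives, so that it serves both [c] and the
    valuations of a form. *)
Definition two_maximal A g psi : Prop :=
  exists u v, [/\ u <> v, maximal A g psi u & maximal A g psi v].

Lemma pairing_pt psi v : pairing psi (pt R v) = \sum_i psi 0 i * (coord v i)%:R.
Proof. by apply: eq_bigr => i _; rewrite mxE. Qed.

Lemma pairing_continuous (x : V) : continuous (fun psi : V => pairing psi x).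
Proof.
rewrite /pairing; elim: (index_enum _) => [|i s IH] psi.
  rewrite (_ : (fun _ => _) = cst 0); first exact: cst_continuous.
  by apply/funext => phi; rewrite big_nil.
rewrite (_ : (fun _ => _) =
  (fun phi : V => phi 0 i * x 0 i) \+ (fun phi : V => \sum_(j <- s) phi 0 j * x 0 j)).
  by apply: continuousD; [apply: continuousM; [exact: coord_continuous|exact: cst_continuous]|exact: IH].
by apply/funext => phi; rewrite big_cons.
Qed.

Lemma pairing_shift psi a v :
  pairing (psi + const_mx a) (pt R v) = pairing psi (pt R v) + a * d%:R.
Proof.
have -> : d%:R = (\sum_i coord v i)%:R :> R by rewrite sum_coord.
rewrite !pairing_pt natr_sum mulr_sumr -big_split /=.
by apply: eq_bigr => i _; rewrite !mxE mulrDl.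
Qed.

Lemma maximal_shift A g psi a v :
  maximal A g (psi + const_mx a) v <-> maximal A g psi v.
Proof.
by split=> -[Av vmax]; split=> // u /vmax; rewrite !pairing_shift !addrA lerD2r.
Qed.

Lemma two_maximal_same_point A g psi psi' :
  same_point psi psi' -> two_maximal A g psi -> two_maximal A g psi'.
Proof.
by move=> [a ->] [u [v [uv um vm]]]; exists u, v; split=> //; apply/maximal_shift.
Qed.

Definition supp (P : mpoly n.+1 K) : pred L := fun v => form_coef P v != 0.

Definition tcoef (P : mpoly n.+1 K) (v : L) : R := - ratr (valuation (form_coef P v)).

Lemma supp_neq0 P : is_form d P -> exists v, supp P v.
Proof.
move=> [P0 Ph]; apply: contrapT => nA; case/eqP: P0; rewrite (form_expand Ph) big1 // => v _.
have [->|Av] := eqVneq (form_coef P v) 0; first by rewrite scale0r.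
by case: nA; exists v.
Qed.

(* [beta v] is the coefficient of the least power of t, over all the terms, in
   the term of [v]. *)
Lemma initial_relation P (z : 'I_n.+1 -> K) : is_form d P -> in_torus z ->
  exists beta : L -> R[i],
    (forall v, beta v != 0 <-> maximal (supp P) (tcoef P) (trop z) v) /\
    forall k : L -> nat, \sum_v form_term P z v *+ k v = 0 ->
      \sum_v beta v * (k v)%:R = 0.
Proof.
move=> Pform z0; have [v0 Av0] := supp_neq0 Pform.
(* For [v] in the support this is the order of its term at [z]. The negative is the tropical value,
   so the maximal monomials are those of least order. *)
pose hq v := valuation (form_coef P v) + \sum_i valuation (z i) *+ coord v i.
have hqE v : tcoef P v + pairing (trop z) (pt R v) = - ratr (hq v).
  rewrite pairing_pt /tcoef /hq rmorphD /= opprD; congr (_ + _).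
  rewrite rmorph_sum -sumrN; apply: eq_bigr => i _.
  by rewrite mxE rmorphMn /= mulNr mulr_natr.
pose b v := form_coef P v (valuation (form_coef P v)) *
  \prod_i z i (valuation (z i)) ^+ coord v i.
have lead v : leads (form_term P z v) (hq v) (b v).
  apply: leadsM; first exact: leads_valuation.
  by apply: leads_prod => i; apply/leadsX/leads_valuation.
have b0 v : supp P v -> b v != 0.
  move=> Av; rewrite mulf_neq0 //; first by case: (puiseux_valuationP Av).
  by apply/prodf_neq0 => i _; rewrite expf_neq0 //; case: (puiseux_valuationP (z0 i)).
clearbody hq b; move: (tcoef P) hqE => g hqE.
case: (Order.TotalTheory.arg_minP hq Av0) => w Aw wmin.
have maxE v : maximal (supp P) g (trop z) v <-> supp P v /\ hq v = hq w.
  split=> [[Av /(_ w Aw)]|[Av vw]].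
    rewrite (hqE v) (hqE w) lerN2 ler_rat => vw; split; first exact: Av.
    by apply/eqP; rewrite eq_le vw; exact: wmin.
  split=> [//|u Au]; rewrite (hqE v) (hqE u) lerN2 ler_rat vw; exact: wmin.
exists (fun v => form_term P z v (hq w)); split=> [v|k sum0]; last first.
  rewrite -[RHS]/((0 : K) (hq w)) -sum0 pcoef_sum; apply: eq_bigr => v _.
  by rewrite pcoefMn mulr_natr.
rewrite maxE; split=> [tv|[Av <-]]; last by case: (lead v) => -> _; exact: b0.
have Av : supp P v.
  by apply: contraNneq tv => Av; rewrite /form_term Av mul0r.
split=> //; apply/eqP; rewrite eq_le wmin // andbT leNgt; apply/negP => wv.
by case: (lead v) => _ /(_ _ wv) /eqP; rewrite (negPf tv).
Qed.

(** The elementary half of Kapranov's theorem: with weights 1 the initial coefficients sum to zero,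
    which a single nonzero one cannot do. *)
Lemma zero_two_maximal P (z : 'I_n.+1 -> K) : is_form d P -> in_torus z ->
  meval z P = 0 -> two_maximal (supp P) (tcoef P) (trop z).
Proof.
move=> Pform z0 Pz; have [beta [betaP beta0]] := initial_relation Pform z0.
have {beta0} : \sum_v beta v = 0.
  rewrite -[RHS](beta0 (fun=> 1%N)); first by apply: eq_bigr => v _; rewrite mulr1.
  by rewrite -[RHS]Pz (meval_form _ (proj2 Pform)).
have [v0 Av0] := supp_neq0 Pform.
case: (Order.TotalTheory.arg_maxP (fun v => tcoef P v + pairing (trop z) (pt R v)) Av0).
move=> u Au umax; have um : maximal (supp P) (tcoef P) (trop z) u by split=> // v /umax.
move=> sum0; apply: contrapT => nt; move/betaP/eqP: (um); apply.
rewrite -[RHS]sum0 (bigD1 u) //= big1 ?addr0 // => v vu.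
apply/eqP/negPn/negP => /betaP vm; apply: nt; exists u, v; split=> //.
by move=> uv; rewrite uv eqxx in vu.
Qed.

(** A sole maximal monomial beats each of the finitely many others strictly, hence throughout a
    neighbourhood. *)
Lemma two_maximal_closure A g (Z : set V) psi : (exists v, A v) ->
  Z `<=` two_maximal A g -> closure Z psi -> two_maximal A g psi.
Proof.
move=> [v0 Av0] ZA clZ; pose h v (phi : V) := g v + pairing phi (pt R v).
case: (Order.TotalTheory.arg_maxP (fun v => h v psi) Av0) => u Au umax'.
have {umax'} umax v : A v -> h v psi <= h u psi by exact: umax'.
apply: contrapT => nt.
have near_u v : A v -> v != u -> \forall phi \near psi, h v phi < h u phi.
  move=> Av vu; have lt : 0 < h u psi - h v psi.
    rewrite subr_gt0 lt_neqAle umax // andbT; apply/eqP => huv.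
    apply: nt; exists u, v; split; first by move=> uv; rewrite uv eqxx in vu.
      by split=> // w Aw; exact: umax.
    by split=> // w Aw; have := umax w Aw; rewrite -huv.
  have cont : {for psi, continuous (fun phi => h u phi - h v phi)}.
    have ch w : continuous (h w).
      rewrite (_ : h w = cst (g w) \+ (fun phi : V => pairing phi (pt R w))) // => phi.
      by apply: continuousD; [exact: cst_continuous|exact: pairing_continuous].
    by rewrite (_ : (fun _ => _) = h u \- h v) //; apply: continuousB; exact: ch.
  have near0 : \forall phi \near psi, 0 < h u phi - h v phi by exact: (cvgr_gt _ cont).
  by near=> phi; rewrite -subr_gt0; near: phi.
have : \forall phi \near psi, forall v, A v -> v != u -> h v phi < h u phi.
  apply: (@filter_forall _ _ (fun v phi => A v -> v != u -> h v phi < h u phi) _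
    (nbhs_filter psi)) => v.
  have [Av|nAv] := boolP (A v); last exact: nearW.
  have [->|vu] := eqVneq v u; first exact: nearW.
  by near=> phi => _ _; near: phi; exact: near_u.
move=> /clZ [phi [/ZA [x [y [xy [Ax xm] [Ay ym]]]] uphi]].
have [xu|xu] := eqVneq x u.
  have yu : y != u by apply/eqP => yu; apply: xy; rewrite xu.
  have := uphi y Ay yu; rewrite ltNge => /negP; apply; exact: ym.
have := uphi x Ax xu; rewrite ltNge => /negP; apply; exact: xm.
Unshelve. all: by end_near.
Qed.

Lemma tropicalization_two_maximal P : is_form d P ->
  tropicalization P `<=` two_maximal (supp P) (tcoef P).
Proof.
move=> Pform psi; apply: two_maximal_closure; first exact: supp_neq0.
move=> phi [z [z0 Pz]] /two_maximal_same_point; apply; exact: zero_two_maximal.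
Qed.

Lemma singular_zero_not_exchange_free P (q : 'I_n.+1 -> K) : (0 < d)%N ->
  is_form d P -> in_torus q -> singular_zero P q ->
  ~ exchange_free (maximal (supp P) (tcoef P) (trop q)).
Proof.
move=> d0 Pform q0 [Pq dPq] free; have [beta [betaP beta0]] := initial_relation Pform q0.
have [u [_ [_ /betaP/eqP bu _]]] := zero_two_maximal Pform q0 Pq; apply: bu.
apply: (exchange_free_indep free d0) => [v|i]; first by move/betaP.
by apply: beta0; rewrite -meval_mderiv_form ?dPq ?mulr0 //; case: Pform.
Qed.

End TropicalMaxima.

(** * Tropical polynomials with absent monomials *)

Section TropicalPolynomial.
Variables (R : realType) (n d : nat).
Local Notation V := 'rV[R]_n.+1.
Local Notation L := (lattice_pt n d).
Variable c : L -> \bar R.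
Hypothesis c_poly : tropical_polynomial c.
Implicit Types (psi x : V) (v u w : L).

Definition esupp : pred L := fun v => c v != -oo%E.

Definition ecoef v : R := fine (c v).

Lemma ecoefE v : esupp v -> c v = (ecoef v)%:E.
Proof.
by rewrite /esupp /ecoef; have := c_poly v; case: (c v) => [r| |] // /(_ erefl).
Qed.

Lemma esuppN v : ~~ esupp v -> c v = -oo%E.
Proof. by move/negPn/eqP. Qed.

Lemma trop_eval_maximal psi v : maximal esupp ecoef psi v ->
  trop_eval c psi = (ecoef v + pairing psi (pt R v))%:E.
Proof.
move=> [Av vmax]; apply/le_anti/andP; split.
  apply/bigmax_leP; split=> [|u _]; first by rewrite leNye.
  have [/[dup] Au /ecoefE ->|/esuppN ->] := boolP (esupp u).
    by rewrite -EFinD lee_fin vmax.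
  by rewrite leNye.
by rewrite EFinD -ecoefE //; exact: le_bigmax.
Qed.

Lemma exists_maximal psi : (exists v, esupp v) -> exists v, maximal esupp ecoef psi v.
Proof.
move=> [v0 Av0].
case: (Order.TotalTheory.arg_maxP (fun v => ecoef v + pairing psi (pt R v)) Av0) => u Au um.
by exists u; split=> // v /um.
Qed.

Lemma trop_fun_maximal psi v : maximal esupp ecoef psi v ->
  trop_fun c psi = ecoef v + pairing psi (pt R v).
Proof. by move=> vm; rewrite /trop_fun (trop_eval_maximal vm). Qed.

Lemma trop_fun_ge psi v : esupp v ->
  ecoef v + pairing psi (pt R v) <= trop_fun c psi.
Proof.
move=> Av; have [u um] := exists_maximal psi (ex_intro _ v Av).
by rewrite (trop_fun_maximal um); apply: um.2.
Qed.

Lemma maximizersP psi v : (exists u, esupp u) ->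
  maximizers c psi v <-> maximal esupp ecoef psi v.
Proof.
move=> /(exists_maximal psi) [u um]; rewrite /maximizers /= (trop_eval_maximal um).
have [/[dup] Av /ecoefE ->|nAv] := boolP (esupp v); last first.
  by rewrite (esuppN nAv) addNye; split=> // -[]; rewrite (negPf nAv).
rewrite -EFinD; split=> [[vu]|vm].
  by split=> // w Aw; rewrite vu; apply: um.2.
by congr EFin; apply/le_anti/andP; split; [apply: um.2|apply: vm.2; case: um].
Qed.

Lemma hypersurface_esupp psi : hypersurface c psi -> exists v, esupp v.
Proof.
move=> hyp; apply: contrapT => nA; apply: hyp.
(* Without monomials [trop_eval c] is constantly [-oo], which [fine] sends to 0. *)
have -> : trop_fun c = cst 0; last exact: differentiable_cst.
apply/funext => phi; rewrite /trop_fun /trop_eval big1_idem //.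
move=> v _; have [Av|/esuppN ->] := boolP (esupp v); first by case: nA; exists v.
by rewrite addNye.
Qed.

Lemma pairingDl psi phi x : pairing (psi + phi) x = pairing psi x + pairing phi x.
Proof. by rewrite -big_split; apply: eq_bigr => i _; rewrite mxE mulrDl. Qed.

Lemma pairingZl a psi x : pairing (a *: psi) x = a * pairing psi x.
Proof. by rewrite /pairing mulr_sumr; apply: eq_bigr => i _; rewrite mxE mulrA. Qed.

Lemma pairing_delta i v : pairing (delta_mx 0 i) (pt R v) = (coord v i)%:R.
Proof.
rewrite pairing_pt (bigD1 i) //= mxE !eqxx mul1r big1 ?addr0 // => j ji.
by rewrite mxE eqxx (negPf ji) mul0r.
Qed.

(* The affine function of a maximal monomial supports [trop_fun] from below, so
   that its slope is the only possible derivative. *)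
Lemma derive_maximal psi v (a : V) : differentiable (trop_fun c) psi ->
  maximal esupp ecoef psi v -> 'D_a (trop_fun c) psi = pairing a (pt R v).
Proof.
move=> /(@diff_derivable _ _ _ _ _ a) /= df vm.
have quot h : h * pairing a (pt R v) <= trop_fun c (h *: a + psi) - trop_fun c psi.
  rewrite (trop_fun_maximal vm) lerBrDr.
  have := trop_fun_ge (h *: a + psi) vm.1.
  by rewrite pairingDl pairingZl; lra.
apply/le_anti/andP; split.
  apply: (cvgr_to_le (cvg_dnbhs_at_left df)).
  near=> h; rewrite [_ *: _]mulrC ler_ndivrMr; last by near: h; exact: nbhs_left_lt.
  by rewrite mulrC; exact: quot.
apply: (cvgr_to_ge (cvg_dnbhs_at_right df)).
near=> h; rewrite [_ *: _]mulrC ler_pdivlMr; last by near: h; exact: nbhs_right_gt.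
by rewrite mulrC; exact: quot.
Unshelve. all: by end_near.
Qed.

Lemma two_maximal_hypersurface psi : two_maximal esupp ecoef psi -> hypersurface c psi.
Proof.
move=> [u [v [uv um vm]]] df; apply: uv; apply: coord_inj => i; apply/eqP.
rewrite -(eqr_nat R) -!(pairing_delta i).
by rewrite -(derive_maximal _ df um) -(derive_maximal _ df vm).
Qed.

End TropicalPolynomial.

(** * The order given by the functional *)

Section LatticeOrder.
Variables (R : realType) (n d : nat).
Local Notation V := 'rV[R]_n.+1.
Local Notation L := (lattice_pt n d).
Implicit Types (v u w : L).

Lemma prec_total v w : v != w -> prec v w \/ prec w v.
Proof.
move=> vw; have [i0 di0] : exists i, coord v i != coord w i.
  apply: contrapT => same; case/eqP: vw; apply: coord_inj => i.
  by apply/eqP/negPn/negP => di; apply: same; exists i.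
have {}di0 : [pred i | coord v i != coord w i] i0 by [].
case: (arg_maxnP (fun i : 'I_n.+1 => val i) di0) => i /= di imax.
have same (j : 'I_n.+1) : (i < j)%N -> coord v j = coord w j.
  by move=> ij; apply/eqP/negPn/negP => /imax; rewrite leqNgt ij.
case: (ltngtP (coord v i) (coord w i)) di => // lt _; first by left; exists i.
by right; exists i; split=> // j /same.
Qed.

Variable phi : V.
Hypothesis phi_order : order_functional d phi.

Lemma pairing_phi_inj v w : pairing phi (pt R v) = pairing phi (pt R w) -> v = w.
Proof.
move=> vw; apply/eqP/negPn/negP => /prec_total[]/(phi_order.2) /=; by rewrite vw ltxx.
Qed.

Lemma pairingDr psi (x y : V) : pairing psi (x + y) = pairing psi x + pairing psi y.
Proof. by rewrite -big_split; apply: eq_bigr => i _; rewrite mxE mulrDr. Qed.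

Lemma pairingZr a psi (x : V) : pairing psi (a *: x) = a * pairing psi x.
Proof. by rewrite /pairing mulr_sumr; apply: eq_bigr => i _; rewrite mxE mulrCA. Qed.

Lemma segment_pt v w u : consecutive [set: L] v w ->
  segment (pt R v) (pt R w) (pt R u) -> u = v \/ u = w.
Proof.
move=> [_ _ /(phi_order.2) vw between] [t [/andP[t0 t1] /(congr1 (pairing phi))]].
rewrite pairingDr !pairingZr => ut.
have [tz|t0'] := eqVneq t 0; first by left; apply: pairing_phi_inj; rewrite ut tz; ring.
have [to|t1'] := eqVneq t 1; first by right; apply: pairing_phi_inj; rewrite ut to; ring.
have tgt0 : 0 < t by rewrite lt_def t0' t0.
have tlt1 : t < 1 by rewrite lt_def eq_sym t1' t1.
by case: (between u) => //; split; apply/(phi_order.2); rewrite ut; nra.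
Qed.

Lemma segment_consecutive_inj v w v' w' :
  consecutive [set: L] v w -> consecutive [set: L] v' w' ->
  segment (pt R v) (pt R w) = segment (pt R v') (pt R w') -> v = v' /\ w = w'.
Proof.
move=> vw vw' E; have [_ _ /(phi_order.2) lt _] := vw.
have [_ _ /(phi_order.2) lt' _] := vw'.
have : segment (pt R v) (pt R w) (pt R v).
  by exists 0; rewrite lexx ler01 subr0 scale1r scale0r addr0.
have : segment (pt R v) (pt R w) (pt R w).
  by exists 1; rewrite lexx ler01 subrr scale1r scale0r add0r.
rewrite E => /(segment_pt vw')[] wE /(segment_pt vw')[] vE; subst v w.
- by rewrite ltxx in lt.
- by have := lt_trans lt lt'; rewrite ltxx.
- by [].
- by rewrite ltxx in lt.
Qed.

End LatticeOrder.

(** * Legendre duality *)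

Section LegendreDuality.
Variables (R : realType) (n d : nat).
Local Notation V := 'rV[R]_n.+1.
Local Notation L := (lattice_pt n d).
Variable c : L -> \bar R.
Hypothesis c_poly : tropical_polynomial c.
Implicit Types (psi x : V) (v u w : L).
Local Notation cmaximal := (maximal (esupp c) (ecoef c)).

Lemma combination_le (alpha b : L -> R) : (forall v, 0 <= alpha v) ->
  (forall v, esupp c v -> ecoef c v <= b v) ->
  (\sum_v (alpha v)%:E * c v <= (\sum_v alpha v * b v)%:E)%E.
Proof.
move=> alpha0 cb; rewrite -sumEFin; apply: lee_sum => v _.
have [/[dup] Av /(ecoefE c_poly) ->|/esuppN ->] := boolP (esupp c v).
  by rewrite -EFinM lee_fin ler_wpM2l // cb.
have [->|a0] := eqVneq (alpha v) 0; first by rewrite mul0e mul0r.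
by rewrite gt0_muleNy ?leNye // lte_fin lt_def a0 alpha0.
Qed.

(** A finite majorant [b] of the coefficients disposes of absent monomials: an affine [b] gives
    Fenchel's inequality, one lowered off a single point a strict form of it. *)
Lemma legendre_ge (b : L -> R) x m : (forall v, esupp c v -> ecoef c v <= b v) ->
  (forall alpha : L -> R, (forall v, 0 <= alpha v) -> \sum_v alpha v = 1 ->
    x = \sum_v alpha v *: pt R v -> \sum_v alpha v * b v <= - m) ->
  (m%:E <= legendre c x)%E.
Proof.
move=> cb bm; apply: le_ereal_inf_tmp => _ [alpha [alpha0 alpha1 xE] <-].
rewrite leeNr -EFinN; apply: le_trans (combination_le alpha0 cb) _.
by rewrite lee_fin; exact: bm.
Qed.

Lemma pairing_combination psi x (alpha : L -> R) : x = \sum_v alpha v *: pt R v ->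
  pairing psi x = \sum_v alpha v * pairing psi (pt R v).
Proof.
move=> ->; elim/big_rec2: _ => [|v s y _ <-].
  by rewrite /pairing big1 // => i _; rewrite mxE mulr0.
by rewrite pairingDr pairingZr.
Qed.

Lemma fenchel psi x : ((pairing psi x - trop_fun c psi)%:E <= legendre c x)%E.
Proof.
apply: (@legendre_ge (fun v => trop_fun c psi - pairing psi (pt R v))).
  by move=> v Av; rewrite lerBrDr; exact: trop_fun_ge.
move=> alpha alpha0 alpha1 /(pairing_combination psi) ->.
rewrite (eq_bigr (fun v => alpha v * trop_fun c psi - alpha v * pairing psi (pt R v))).
  by rewrite sumrB -mulr_suml alpha1 mul1r opprB.
by move=> v _; rewrite mulrBr.
Qed.

Lemma legendre_pt_le v : (legendre c (pt R v) <= - c v)%E.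
Proof.
apply: ereal_inf_lbound; exists (fun u => (u == v)%:R).
  split=> [u||]; first by rewrite ler0n.
    by rewrite (bigD1 v) //= eqxx big1 ?addr0 // => u /negPf ->.
  by rewrite (bigD1 v) //= eqxx scale1r big1 ?addr0 // => u /negPf ->; rewrite scale0r.
congr (- _)%E; rewrite (bigD1 v) //= eqxx mul1e big1 ?adde0 // => u /negPf ->.
by rewrite mul0e.
Qed.

Lemma Delta_pt v : Delta d (pt R v).
Proof.
split=> [i|]; first by rewrite mxE ler0n.
by rewrite -[in RHS](sum_coord v) natr_sum; apply: eq_bigr => i _; rewrite mxE.
Qed.

(* The weight at [w] of a convex combination representing [v] is bounded away
   from 1, by a coordinate in which [w] exceeds [v]. *)
Lemma legendre_gap psi v w : v <> w ->
  (forall u, cmaximal psi u -> u = w) ->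
  ((pairing psi (pt R v) - trop_fun c psi)%:E < legendre c (pt R v))%E.
Proof.
move=> vw only_w; set T := trop_fun c psi.
pose gap u := T - (ecoef c u + pairing psi (pt R u)).
(* The least defect of the other monomials, capped at 1 so that it makes sense when there are
   none. *)
pose eps := \big[Num.min/1]_(u | esupp c u && (u != w)) gap u.
have eps0 : 0 < eps.
  apply: lt_bigmin => [|u]; first exact: ltr01.
  case/andP=> Au uw; rewrite subr_gt0 lt_neqAle trop_fun_ge // andbT.
  apply/eqP => uT; case/eqP: uw; apply: only_w; split=> // y Ay; rewrite uT.
  exact: trop_fun_ge.
have epsP u : esupp c u -> u != w -> eps <= gap u.
  by move=> Au uw; apply: bigmin_le_cond; rewrite Au.
have [j vwj] : exists j, (coord v j < coord w j)%N.
  apply: contrapT => nj; apply: vw; apply: coord_inj => i; apply/esym/eqP.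
  have le k : (coord w k <= coord v k)%N.
    by rewrite leqNgt; apply/negP => lt; apply: nj; exists k.
  have : (\sum_k coord w k == \sum_k coord v k)%N by rewrite !sum_coord.
  by rewrite (leqif_sum (fun k _ => leqif_eq (le k))).2 => /forallP/(_ i).
have wj0 : 0 < (coord w j)%:R :> R by rewrite ltr0n; case: (coord w j) vwj.
(* Coordinate [j] of the convex combination gives [alpha w <= coord v j / coord w j], which is
   [1 - kappa]. *)
pose kappa : R := ((coord w j)%:R - (coord v j)%:R) / (coord w j)%:R.
have kappa0 : 0 < kappa by rewrite divr_gt0 // subr_gt0 ltr_nat.
apply: (@lt_le_trans _ _ (pairing psi (pt R v) - T + eps * kappa)%:E).
  by rewrite lte_fin ltrDl mulr_gt0.
apply: (@legendre_ge (fun u => T - pairing psi (pt R u) - (u != w)%:R * eps)).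
  move=> u Au; have [uw|uw] := eqVneq u w.
    by rewrite /= mul0r subr0 lerBrDr trop_fun_ge.
  by have := epsP u Au uw; rewrite /gap /= mul1r; lra.
move=> alpha alpha0 alpha1 vE; rewrite (pairing_combination psi vE).
have alpha_w : alpha w <= 1 - kappa.
  have -> : 1 - kappa = (coord v j)%:R / (coord w j)%:R.
    by rewrite /kappa; field; rewrite gt_eqF.
  rewrite ler_pdivlMr //.
  have -> : (coord v j)%:R = \sum_u alpha u * (coord u j)%:R.
    move/(congr1 (fun x : V => x 0 j)): vE; rewrite mxE summxE => ->.
    by apply: eq_bigr => u _; rewrite !mxE.
  rewrite (bigD1 w) //= lerDl sumr_ge0 // => u _.
  by rewrite mulr_ge0 ?ler0n.
have -> : \sum_u alpha u * (T - pairing psi (pt R u) - (u != w)%:R * eps) =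
    T - \sum_u alpha u * pairing psi (pt R u) - (1 - alpha w) * eps.
  rewrite (eq_bigr (fun u => alpha u * T - alpha u * pairing psi (pt R u) -
    alpha u * (u != w)%:R * eps)); last by move=> u _; ring.
  rewrite !sumrB -!mulr_suml alpha1 mul1r; congr (_ - _ * eps).
  have <- : \sum_(i | i != w) alpha i = 1 - alpha w.
    by rewrite -alpha1 [in RHS](bigD1 w) //= addrAC subrr add0r.
  by rewrite (bigD1 w) //= eqxx mulr0 add0r; apply: eq_bigr => u ->; exact: mulr1.
have : eps * kappa <= (1 - alpha w) * eps by rewrite mulrC ler_pM2r //; lra.
by lra.
Qed.

End LegendreDuality.

(** * From edges of the path to maximal monomials *)

Section DualPath.
Variables (R : realType) (n d : nat) (phi : 'rV[R]_n.+1).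
Local Notation V := 'rV[R]_n.+1.
Local Notation L := (lattice_pt n d).
Hypothesis phi_order : order_functional d phi.
Variable c : L -> \bar R.
Hypothesis c_poly : tropical_polynomial c.
Implicit Types (psi : V) (v u w : L).
Local Notation cmaximal := (maximal (esupp c) (ecoef c)).

Lemma dual_cell_maximal (C : set V) psi0 v : (exists u, esupp c u) ->
  C = [set psi | maximizers c psi0 `<=` maximizers c psi] ->
  cmaximal psi0 v -> dual_cell c C (pt R v).
Proof.
move=> nonempty CE vm0; split=> [|psi]; first exact: Delta_pt.
rewrite CE => /(_ v) vC; have /(maximizersP c_poly _ _ nonempty) vm : maximizers c psi v.
  by apply/vC/(maximizersP c_poly).
apply/le_anti/andP; split; last exact: fenchel.
apply: le_trans (legendre_pt_le c v) _.
rewrite (ecoefE c_poly vm.1) (trop_fun_maximal c_poly vm) lee_fin.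
by rewrite opprD addrCA subrr addr0.
Qed.

(* Moving from [psi0] through a relative interior point [psi] of the cell of
   [psi0] and slightly beyond, a monomial that became maximal at [psi] only
   would overtake the others. *)
Lemma relint_maximal (C : set V) psi0 psi u : (exists v, esupp c v) ->
  C = [set psi' | maximizers c psi0 `<=` maximizers c psi'] ->
  relint C psi -> cmaximal psi u -> cmaximal psi0 u.
Proof.
move=> nonempty CE [Cpsi hull] um.
have [v vm0] := exists_maximal psi0 nonempty.
have Cmax psi' : C psi' -> cmaximal psi' v.
  rewrite CE => /(_ v) vC; apply/(maximizersP c_poly _ _ nonempty)/vC.
  exact/(maximizersP c_poly).
have Cpsi0 : C psi0 by rewrite CE.
pose y (e : R) : V := (1 + e) *: psi + (- e) *: psi0.
have y_hull e : affine_hull C (y e).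
  exists 2, (fun i : 'I_2 => if i == ord0 then psi else psi0),
    (fun i : 'I_2 => if i == ord0 then 1 + e else - e); split.
  - by move=> i; case: ifP.
  - by rewrite !big_ord_recl big_ord0 /= addr0 addrK.
  - by rewrite !big_ord_recl big_ord0 /= addr0.
have y_cvg : y e @[e --> 0^'+] --> psi.
  apply: cvg_at_right_filter.
  have {1}-> : psi = y 0 by rewrite /y addr0 oppr0 scale0r addr0 scale1r.
  apply: cvgD; apply: cvgZr_tmp.
    by apply: cvgD; [exact: cvg_cst|exact: cvg_id].
  by apply: cvgN; exact: cvg_id.
have [e [e0 Ce]] : exists e, 0 < e /\ C (y e).
  have near_C : \forall e \near 0^'+, affine_hull C (y e) -> C (y e).
    exact: (y_cvg _ hull).
  have near_pos : \forall e \near (0 : R)^'+, 0 < e by exact: nbhs_right_gt.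
  have [e [Ce e0]] :=
    @filter_ex _ _ (at_right_proper_filter (0 : R)) _ (filterI near_C near_pos).
  by exists e; split=> //; exact: Ce.
split=> [|w Aw]; first exact: um.1.
apply: le_trans (vm0.2 w Aw) _.
have := (Cmax _ Ce).2 u um.1; rewrite !(pairingDl, pairingZl).
have := um.2 v vm0.1; have := (Cmax _ Cpsi).2 u um.1; nra.
Qed.

(** The monomials maximal at [psi0] lie in the dual cell, a segment whose only lattice points are
    its ends. Both ends occur: if one were maximal alone, [legendre_gap] would make Fenchel's
    inequality strict at the other, which belongs to the cell. *)
Lemma dual_path_maximal (I : Type) (chi : I -> V) v w :
  consecutive [set: L] v w -> dual_path c chi (segment (pt R v) (pt R w)) ->
  exists i, forall u, cmaximal (chi i) u <-> u = v \/ u = w.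
Proof.
move=> vw [_ _ [i [C [[psi0 CE] Chyp _ relC E]]]]; exists i.
have [Cchi _] := relC.
have nonempty := hypersurface_esupp (Chyp _ Cchi).
have Cpsi0 : C psi0 by rewrite CE.
have only u : cmaximal psi0 u -> u = v \/ u = w.
  move=> um; apply: (segment_pt phi_order vw); rewrite E.
  exact: dual_cell_maximal nonempty CE um.
have [u0 u0m] := exists_maximal psi0 nonempty.
have legendreE u : segment (pt R v) (pt R w) (pt R u) ->
    legendre c (pt R u) = (pairing psi0 (pt R u) - trop_fun c psi0)%:E.
  by rewrite E => -[_ /(_ _ Cpsi0)].
have [_ _ /(phi_order.2) lt _] := vw.
have neq : v <> w by move=> eq; rewrite eq ltxx in lt.
have vm : cmaximal psi0 v.
  apply: contrapT => nvm; have /(legendre_gap c_poly neq) : forall u, cmaximal psi0 u -> u = w.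
    by move=> u um; case: (only u um) => // uv; case: nvm; rewrite -uv.
  rewrite legendreE ?ltxx //.
  by exists 0; rewrite lexx ler01 subr0 scale1r scale0r addr0.
have wm : cmaximal psi0 w.
  apply: contrapT => nwm.
  have /(legendre_gap c_poly (nesym neq)) : forall u, cmaximal psi0 u -> u = v.
    by move=> u um; case: (only u um) => // uw; case: nwm; rewrite -uw.
  rewrite legendreE ?ltxx //.
  by exists 1; rewrite lexx ler01 subrr scale1r scale0r add0r.
have to_chi u : cmaximal psi0 u -> cmaximal (chi i) u.
  move=> um; apply/(maximizersP c_poly _ _ nonempty).
  by move: Cchi; rewrite CE; apply; apply/(maximizersP c_poly).
move=> u; split=> [um|]; last by case=> ->; exact: to_chi.
by apply: only; exact: relint_maximal nonempty CE relC um.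
Qed.

End DualPath.

(** * Enumeration of the lattice points *)

Section LatticeEnumeration.
Variables (R : realType) (n d : nat).
Local Notation L := (lattice_pt n d).
Implicit Types (v u w x : L).

Lemma precP (phi : 'rV[R]_n.+1) v w : order_functional d phi ->
  prec v w <-> pairing phi (pt R v) < pairing phi (pt R w).
Proof. by case=> _ /(_ v w) []; split. Qed.

Lemma prec_minimal_corner u : (forall v, ~ prec v u) -> coord u ord0 = d.
Proof.
move=> umin; apply: contrapT => u0.
have [i i0 ui] : exists2 i : 'I_n.+1, i != ord0 & (0 < coord u i)%N.
  apply: contrapT => ni; apply: u0; rewrite -[RHS](sum_coord u) (bigD1 ord0) //=.
  rewrite big1 ?addn0 // => i i0; apply/eqP; rewrite -leqn0 leqNgt; apply/negP => ui.
  by apply: ni; exists i.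
have i0' : ord0 != i by rewrite eq_sym.
have [x xE] := exchange_pt i0' ui; apply: (umin x); exists i; split.
  by have := xE i; rewrite eqxx (negPf i0); lia.
move=> j ij; have := xE j; have [ji|_] := eqVneq j i; first by rewrite ji ltnn in ij.
by have [j0|_] := eqVneq j ord0; [rewrite j0 in ij|lia].
Qed.

Lemma prec_maximal_corner u : (forall v, ~ prec u v) -> coord u ord_max = d.
Proof.
move=> umax; apply: contrapT => u0.
have [i i0 ui] : exists2 i : 'I_n.+1, i != ord_max & (0 < coord u i)%N.
  apply: contrapT => ni; apply: u0; rewrite -[RHS](sum_coord u) (bigD1 ord_max) //=.
  rewrite big1 ?addn0 // => i i0; apply/eqP; rewrite -leqn0 leqNgt; apply/negP => ui.
  by apply: ni; exists i.
have i0' : ord_max != i by rewrite eq_sym.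
have [x xE] := exchange_pt i0' ui; apply: (umax x); exists ord_max; split.
  by have := xE ord_max; rewrite eqxx (negPf i0'); lia.
by move=> j; rewrite ltnNge leq_ord.
Qed.

Lemma card_lattice_pt : (0 < d)%N -> (n < #|{: L}|)%N.
Proof.
move=> d0; have corner (i : 'I_n.+1) : exists v : L, forall k, coord v k = ((k == i) * d)%N.
  apply: lattice_ptP; rewrite (bigD1 i) //= eqxx mul1n big1 ?addn0 // => k /negPf ->.
  by rewrite mul0n.
have [f fE] := choice corner.
suff /leq_card : injective f by rewrite card_ord.
move=> i j ij; apply/eqP/negPn/negP => nij.
have := fE i i; rewrite ij fE eqxx (negPf nij); lia.
Qed.

Variable phi : 'rV[R]_n.+1.
Hypothesis phi_order : order_functional d phi.
Local Notation sz := #|{: L}|.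

Lemma lattice_enumeration : L -> exists e : nat -> L,
  (forall i j, (i < j)%N -> (j < sz)%N -> prec (e i) (e j)) /\
  (forall v, exists2 i, (i < sz)%N & e i = v).
Proof.
move=> v0; pose le v w := pairing phi (pt R v) <= pairing phi (pt R w).
pose s := sort le (enum {: L}).
have sz_s : size s = sz by rewrite size_sort -cardE.
have s_uniq : uniq s by rewrite sort_uniq enum_uniq.
have s_sorted : sorted le s by apply: sort_sorted => v w; exact: le_total.
exists (fun i => nth v0 s i); split=> [i j ij jsz|v].
  have isz := ltn_trans ij jsz.
  apply/(precP _ _ phi_order); rewrite lt_neqAle; apply/andP; split.
    apply/eqP => /(pairing_phi_inj phi_order) /eqP.
    by rewrite nth_uniq ?sz_s // => /eqP ijE; rewrite ijE ltnn in ij.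
  by apply: (sorted_ltn_nth _ v0 s_sorted) => //; [move=> ? ? ?; exact: le_trans|
    rewrite inE sz_s|rewrite inE sz_s].
exists (index v s); last by rewrite nth_index // mem_sort mem_enum.
by rewrite -sz_s index_mem mem_sort mem_enum.
Qed.

End LatticeEnumeration.

(** * Breakpoints on the line *)

Section Line.
Variables (R : realType) (n d : nat) (phi : 'rV[R]_n.+1).
Local Notation V := 'rV[R]_n.+1.
Local Notation L := (lattice_pt n d).
Hypothesis phi_order : order_functional d phi.
Variable e : nat -> L.
Hypothesis e_prec : forall i j, (i < j)%N -> (j < #|{: L}|)%N -> prec (e i) (e j).
Hypothesis e_surj : forall v, exists2 i, (i < #|{: L}|)%N & e i = v.
Implicit Types (A : pred L) (g : L -> R) (S : nat -> R) (v u t x y : L).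
Local Notation sz := #|{: L}|.
Local Notation lambda v := (pairing phi (pt R v)).

Lemma e_lt i j : (i < j)%N -> (j < sz)%N -> lambda (e i) < lambda (e j).
Proof. by move=> ij /(e_prec ij) /(precP _ _ phi_order). Qed.

Lemma e_lt_inv i j : (i < sz)%N -> lambda (e i) < lambda (e j) -> (i < j)%N.
Proof.
move=> isz lt; rewrite ltnNge leq_eqVlt; apply/negP => /orP[/eqP ji|ji].
  by rewrite ji ltxx in lt.
by have := lt_trans lt (e_lt ji isz); rewrite ltxx.
Qed.

Lemma e_le_inv i j : (i < sz)%N -> lambda (e i) <= lambda (e j) -> (j < sz)%N -> (i <= j)%N.
Proof.
by move=> isz le jsz; rewrite leqNgt; apply/negP => /e_lt /(_ isz); rewrite ltNge le.
Qed.

Lemma e_inj i j : (i < sz)%N -> (j < sz)%N -> e i = e j -> i = j.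
Proof.
by move=> isz jsz ij; apply/anti_leq/andP; split; apply: e_le_inv; rewrite ?ij.
Qed.

Lemma e_consecutive i : (i.+1 < sz)%N -> consecutive [set: L] (e i) (e i.+1).
Proof.
move=> isz; split=> //; first exact: e_prec.
move=> u _ []; have [j jsz <-] := e_surj u.
move=> /(precP _ _ phi_order) /e_lt_inv ij /(precP _ _ phi_order) /e_lt_inv ji.
by have := ij (ltnW isz); have := ji jsz; lia.
Qed.

Lemma consecutive_e v w : consecutive [set: L] v w ->
  exists i, [/\ (i.+1 < sz)%N, v = e i & w = e i.+1].
Proof.
have [i isz <-] := e_surj v; have [j jsz <-] := e_surj w.
move=> [_ _ /(precP _ _ phi_order) /(e_lt_inv isz) ij between].
have [ij'|ji] := ltnP i.+1 j.
  by case: (between (e i.+1)) => //; split; apply: e_prec => //; exact: ltn_trans jsz.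
have jE : j = i.+1 by apply/eqP; rewrite eqn_leq ji.
by exists i; rewrite -jE.
Qed.

(** Slopes of a convex function increase: the two maximality inequalities add up to
    [(s' - s) * (lambda u - lambda t) >= 0]. *)
Lemma maximal_monotone A g s s' t u : s < s' ->
  maximal A g (s *: phi) t -> maximal A g (s' *: phi) u -> lambda t <= lambda u.
Proof.
move=> ss [At tmax] [Au umax]; have := tmax u Au; have := umax t At.
by rewrite !pairingZl; nra.
Qed.

Definition breakpoint A g k s : Prop :=
  forall u, maximal A g (s *: phi) u <-> u = e k \/ u = e k.+1.

Lemma breakpoint_two_maximal A g k s : (k.+1 < sz)%N -> breakpoint A g k s ->
  two_maximal A g (s *: phi).
Proof.
move=> ksz bp; exists (e k), (e k.+1); split; [|by apply/bp; left|by apply/bp; right].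
by move=> /e_inj; lia.
Qed.

Lemma breakpoint_increasing A g k l s s' : (k < l)%N -> (l.+1 < sz)%N ->
  breakpoint A g k s -> breakpoint A g l s' -> s < s'.
Proof.
move=> kl lsz bpk bpl; rewrite ltNge le_eqVlt; apply/negP => /orP[/eqP ss|ss].
  have /bpk[] : maximal A g (s *: phi) (e l.+1) by rewrite -ss; apply/bpl; right.
    by move=> /e_inj; lia.
  by move=> /e_inj; lia.
have : lambda (e l.+1) <= lambda (e k).
  by apply: (maximal_monotone ss); [apply/bpl; right|apply/bpk; left].
by rewrite leNgt e_lt //; lia.
Qed.

(* Each breakpoint advances the maximal monomial by at least one step, and there
   are as many breakpoints as steps. *)
Lemma breakpoint_count A g S a b : (b < sz)%N ->
  (forall k, (a <= k < b)%N -> two_maximal A g (S k *: phi)) ->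
  (forall k l, (a <= k)%N -> (k < l)%N -> (l < b)%N -> S k < S l) ->
  (forall i, (i < sz)%N -> A (e i) -> (a <= i <= b)%N) ->
  forall k, (a <= k < b)%N -> breakpoint A g k (S k).
Proof.
move=> bsz two incr Aab.
have pair k : (a <= k < b)%N -> exists i j, [/\ (i < j)%N, (j < sz)%N,
    maximal A g (S k *: phi) (e i) & maximal A g (S k *: phi) (e j)].
  move=> /two [u [v []]]; have [i isz <-] := e_surj u; have [j jsz <-] := e_surj v.
  move=> ij im jm; case: (ltngtP i j) => [lt|lt|E]; last by rewrite E in ij.
    by exists i, j.
  by exists j, i.
(* Counted from the left, each earlier breakpoint has used up a monomial; [high] is the same count
   from the right. *)
have low m i : (a + m < b)%N -> (i < sz)%N ->
    maximal A g (S (a + m)%N *: phi) (e i) -> (a + m <= i)%N.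
  elim: m i => [|m IH] i mb isz im.
    by rewrite addn0; have := Aab i isz im.1; lia.
  have [|i0 [j0 [ij0 jsz im0 jm0]]] := pair (a + m)%N; first by lia.
  have : (a + m <= i0)%N by apply: IH im0; lia.
  have : (j0 <= i)%N; last by lia.
  by apply: e_le_inv => //; apply: maximal_monotone jm0 im; apply: incr; lia.
have high m k j : (a <= k < b)%N -> (k + m.+1 = b)%N -> (j < sz)%N ->
    maximal A g (S k *: phi) (e j) -> (j <= k.+1)%N.
  elim: m k j => [|m IH] k j kb kmb jsz jm.
    by have := Aab j jsz jm.1; lia.
  have kb' : (a <= k.+1 < b)%N by lia.
  have [i0 [j0 [ij0 j0sz im0 jm0]]] := pair k.+1 kb'.
  have : (j0 <= k.+2)%N by apply: IH => //; lia.
  have : (j <= i0)%N; last by lia.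
  apply: e_le_inv => //; last by lia.
  by apply: maximal_monotone jm im0; apply: incr; lia.
move=> k kb; have bounds i : (i < sz)%N -> maximal A g (S k *: phi) (e i) ->
    (k <= i <= k.+1)%N.
  move=> isz im; apply/andP; split; last by apply: (high (b - k.+1)%N) im => //; lia.
  have kE : (a + (k - a) = k)%N by lia.
  by have := low (k - a)%N i; rewrite kE => H; apply: (H _ isz im); lia.
have [i [j [ij jsz im jm]]] := pair k kb.
have := bounds j jsz jm; have := bounds i (ltn_trans ij jsz) im => bi bj.
have iE : i = k by lia.
have jE : j = k.+1 by lia.
subst i j; move=> u; split=> [um|[->|->]] //.
have [l lsz ul] := e_surj u; rewrite -ul in um *.
have := bounds l lsz um => bl.
have [->|lE] : l = k \/ l = k.+1 by lia.
  by left.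
by rewrite lE; right.
Qed.

(* Along the line the coefficients form a strictly concave function of
   [lambda], so that moving two monomials towards each other increases the sum
   of their coefficients. *)
Lemma breakpoint_exchange_free A g S a b psi : (b < sz)%N ->
  (forall k, (a <= k < b)%N -> breakpoint A g k (S k)) ->
  (forall i, (i < sz)%N -> A (e i) -> (a <= i <= b)%N) ->
  exchange_free (maximal A g psi).
Proof.
move=> bsz bp Aab u t x y um tm sumE ux xt.
have pairE psi' : pairing psi' (pt R x) + pairing psi' (pt R y) =
    pairing psi' (pt R u) + pairing psi' (pt R t).
  rewrite !pairing_pt -!big_split /=; apply: eq_bigr => i _.
  by rewrite -!mulrDr -!natrD sumE.
move/(precP _ _ phi_order): ux => ux; move/(precP _ _ phi_order): xt => xt.
have := pairE psi; have := pairE phi; clear sumE pairE.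
(* The roles are symmetric: the equality of sums under [phi] puts [y] between [u] and [t] as
   well. *)
wlog xy : x y ux xt / lambda x <= lambda y.
  move=> H lE pE; have [xy|/ltW yx] := leP (lambda x) (lambda y); first exact: (H x y).
  by apply: (H y x) => //; lra.
move=> lE pE.
have [iu iusz iuE] := e_surj u; have [it itsz itE] := e_surj t.
have [ix ixsz ixE] := e_surj x; have [iy iysz iyE] := e_surj y; subst u t x y.
have /(Aab iu iusz) iu_ab := um.1; have /(Aab it itsz) it_ab := tm.1.
have iux := e_lt_inv iusz ux; have ixt := e_lt_inv ixsz xt.
have ixy := e_le_inv ixsz xy iysz.
have iyt : (iy < it)%N by apply: e_lt_inv => //; lra.
have ix_ab : (a <= ix < b)%N by lia.
have bpx := bp ix ix_ab.
have xm : maximal A g (S ix *: phi) (e ix) by apply/bpx; left.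
have strict : g (e iu) + S ix * lambda (e iu) < g (e ix) + S ix * lambda (e ix).
  rewrite -!pairingZl lt_neqAle xm.2 ?andbT; last exact: um.1.
  apply/eqP => same; suff /bpx[] : maximal A g (S ix *: phi) (e iu).
  - by move=> /e_inj; lia.
  - by move=> /e_inj; lia.
  by split=> [|w Aw]; [exact: um.1|rewrite same; exact: xm.2].
(* As [y] is still maximal at some [s'] not left of [S ix], the slope of [g] from [u] to [x]
   strictly exceeds that from [y] to [t]. The two steps have equal length, so [g] has a larger sum
   on [x], [y] than on [u], [t]. *)
have [s' ss' ym] : exists2 s', S ix <= s' & maximal A g (s' *: phi) (e iy).
  have [<-|ixy'] := eqVneq ix iy; first by exists (S ix).
  have iy_ab : (a <= iy.-1 < b)%N by lia.
  have bpy := bp _ iy_ab; have iyE : iy.-1.+1 = iy by lia.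
  exists (S iy.-1); last by apply/bpy; right; rewrite iyE.
  have [->//|ne] := eqVneq ix iy.-1.
  by apply/ltW/(breakpoint_increasing _ _ bpx bpy); lia.
have := ym.2 (e it) tm.1; rewrite !pairingZl => yt.
have := um.2 (e ix) xm.1; have := tm.2 (e iy) ym.1.
nra.
Qed.

End Line.

(** * Polynomials without a corner monomial *)

Section MissingCorner.
Variables (R : realType) (n d : nat).
Local Notation V := 'rV[R]_n.+1.
Local Notation L := (lattice_pt n d).
Implicit Types (A : pred L) (g : L -> R) (v u x y : L).

(* At [K e_i0 - \sum_i b_i e_i] the monomials of degree [d - 1] in the variable
   [i0] are all maximal for the first polynomial when [K] is large, whereas the
   power of the variable [i0] would dominate alone the second one. *)
Lemma missing_corner A g A' g' (i0 : 'I_n.+1) v0 : (2 <= n)%N -> (0 < d)%N ->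
  coord v0 i0 = d -> (forall v, A v = (v != v0)) ->
  (forall psi : V, two_maximal A g psi -> two_maximal A' g' psi) -> ~~ A' v0.
Proof.
move=> n2 d0 v0d AE two; apply/negP => A'v0.
have v0_out k : k != i0 -> coord v0 k = 0%N.
  move=> ki0; have := sum_coord v0; rewrite (bigD1 i0) //= v0d (bigD1 k) //=; lia.
have near_corner k : exists x, k != i0 ->
    forall j, (coord x j + (j == i0) = coord v0 j + (j == k))%N.
  have [->|ki0] := eqVneq k i0; first by exists v0.
  by have [|x xE] := @exchange_pt n d v0 k i0 ki0; [rewrite v0d|exists x].
have {near_corner} [P PE] := choice near_corner.
(* Subtracting [b] levels the neighbours [P k] of the corner [v0], all at the value
   [(d - 1) * K]. *)
pose b k : R := if k == i0 then 0 else g (P k).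
pose B v : R := \sum_k b k * (coord v k)%:R.
pose K : R := 1 + \sum_v (`|g v - B v| + `|g' v - B v| + `|g' v - B v|).
have boundK v : `|g v - B v| + `|g' v - B v| + `|g' v - B v| < K.
  rewrite /K (bigD1 v) //= addrCA ltrDl ltr_wpDr //.
  by apply: sumr_ge0 => u _; rewrite !addr_ge0.
pose psi : V := \row_k ((k == i0)%:R * K - b k).
have psiE v : pairing psi (pt R v) = (coord v i0)%:R * K - B v.
  rewrite pairing_pt /B (eq_bigr (fun k => (k == i0)%:R * K * (coord v k)%:R -
    b k * (coord v k)%:R)); last by move=> k _; rewrite mxE mulrBl.
  rewrite sumrB (bigD1 i0) //= eqxx big1 ?addr0 => [|k /negPf ->]; last by rewrite !mul0r.
  by rewrite mul1r mulrC.
have K_gt0 : 0 < K by apply: le_lt_trans (boundK v0); rewrite !addr_ge0.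
have lt_d v : v != v0 -> (coord v i0 < d)%N.
  move=> vv0; rewrite ltn_neqAle; apply/andP; split; last first.
    by rewrite -[X in (_ <= X)%N](sum_coord v) (bigD1 i0) //= leq_addr.
  apply: contraNneq vv0 => vd; apply/eqP/coord_inj => k.
  have [->|ki0] := eqVneq k i0; first by rewrite vd.
  by have := sum_coord v; rewrite v0_out // (bigD1 i0) //= vd (bigD1 k) //=; lia.
have dE : d%:R = (d.-1)%:R + 1 :> R by rewrite natr1 prednK.
(* Since [n >= 2], two variables other than [i0] exist, hence two distinct neighbours tied at
   [psi]. *)
have [k [l [ki0 li0 kl]]] : exists k l : 'I_n.+1, [/\ k != i0, l != i0 & k != l].
  have : (1 < #|predC1 i0|)%N by rewrite cardC1 card_ord.
  by case/card_gt1P => k [l [ki0 li0 kl]]; exists k, l.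
have P_i0 j : j != i0 -> coord (P j) i0 = d.-1.
  by move=> ji0; have := PE j ji0 i0; rewrite eqxx v0d eq_sym (negPf ji0); lia.
have P_out j m : j != i0 -> m != i0 -> coord (P j) m = (m == j).
  by move=> ji0 mi0; have := PE j ji0 m; rewrite (negPf mi0) addn0 v0_out.
have P_val j : j != i0 -> g (P j) + pairing psi (pt R (P j)) = (d.-1)%:R * K.
  move=> ji0; rewrite psiE P_i0 // /B (bigD1 j) //= P_out // eqxx mulr1.
  rewrite big1 ?addr0 /b ?(negPf ji0) => [|m mj]; first by ring.
  have [mi0|mi0] := eqVneq m i0; first by rewrite mul0r.
  by rewrite P_out // (negPf mj) mulr0.
have P_max j : j != i0 -> maximal A g psi (P j).
  move=> ji0; split=> [|v]; rewrite AE.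
    by apply/eqP => Pv0; have := P_i0 j ji0; rewrite Pv0 v0d; lia.
  move=> vv0; rewrite P_val //; have [vd|vd] := eqVneq (coord v i0) d.-1; last first.
    have vd' : (coord v i0)%:R + 1 <= (d.-1)%:R :> R.
      by rewrite natr1 ler_nat ltn_neqAle vd; have := lt_d v vv0; lia.
    have gb : g v - B v < K.
      apply: le_lt_trans (ler_norm _) _; apply: le_lt_trans (boundK v).
      by rewrite -addrA lerDl addr_ge0.
    have := ler_wpM2r (ltW K_gt0) vd'; rewrite psiE mulrDl mul1r; lra.
  have [m mi0 vm] : exists2 m, m != i0 & (0 < coord v m)%N.
    apply: contrapT => nm; have := sum_coord v; rewrite (bigD1 i0) //= vd big1; first lia.
    by move=> m mi0; apply/eqP; rewrite -leqn0 leqNgt; apply/negP => vm; apply: nm; exists m.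
  have -> : v = P m; last by rewrite P_val.
  apply: coord_inj => r; have [->|ri0] := eqVneq r i0; first by rewrite P_i0.
  rewrite P_out //; have := sum_coord v; rewrite (bigD1 i0) //= vd (bigD1 m) //=.
  have [->|rm] := eqVneq r m; first by lia.
  by rewrite (bigD1 r) ?ri0 //=; lia.
have [] : two_maximal A' g' psi.
  apply: two; exists (P k), (P l); split; [|exact: P_max|exact: P_max].
  move=> PkPl; have := P_out k k ki0 ki0; rewrite PkPl P_out // eqxx.
  by rewrite eq_sym eq_sym (negPf kl).
move=> x [y [xy xm ym]]; have [z zv0 zm] : exists2 z, z != v0 & maximal A' g' psi z.
  have [xv0|xv0] := eqVneq x v0; last by exists x.
  by exists y => //; apply/eqP => yv0; apply: xy; rewrite xv0.
have zd : (coord z i0)%:R <= (d.-1)%:R :> R by rewrite ler_nat; have := lt_d z zv0; lia.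
have := zm.2 v0 A'v0; rewrite !psiE v0d dE.
have := ler_wpM2r (ltW K_gt0) zd.
have : g' z - B z - (g' v0 - B v0) < K; last by lra.
apply: (@le_lt_trans _ _ (`|g' z - B z| + `|g' v0 - B v0|)).
  by apply: lerD; [exact: ler_norm|rewrite -normrN ler_norm].
have zv := boundK z; rewrite /K (bigD1 z) //= (bigD1 v0) ?[v0 == z]eq_sym //=.
have rest : 0 <= \sum_(i | (i != z) && (i != v0))
    (`|g i - B i| + `|g' i - B i| + `|g' i - B i|).
  by apply: sumr_ge0 => u _; rewrite !addr_ge0.
have := normr_ge0 (g z - B z); have := normr_ge0 (g' z - B z).
have := normr_ge0 (g v0 - B v0); have := normr_ge0 (g' v0 - B v0).
lra.
Qed.

End MissingCorner.

(** * The gap in the path *)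

Section Gap.
Variables (R : realType) (n d : nat) (phi : 'rV[R]_n.+1).
Local Notation V := 'rV[R]_n.+1.
Local Notation L := (lattice_pt n d).
Local Notation sz := #|{: L}|.
Local Notation lambda v := (pairing phi (pt R v)).
Hypotheses (phi_order : order_functional d phi) (n2 : (2 <= n)%N) (d0 : (0 < d)%N).
Variable e : nat -> L.
Hypothesis e_prec : forall i j, (i < j)%N -> (j < sz)%N -> prec (e i) (e j).
Hypothesis e_surj : forall v, exists2 i, (i < sz)%N & e i = v.
Variables (A : pred L) (g : L -> R) (k0 : nat).
Hypothesis k0sz : (k0.+1 < sz)%N.
Hypothesis bp : forall k, (k.+1 < sz)%N -> k != k0 -> exists s, breakpoint phi e A g k s.
Let e_lt := e_lt phi_order e_prec.
Let e_inj := e_inj phi_order e_prec.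

(* Across the gap the breakpoint is where the two monomials are equal; strict
   maximality of these at the neighbouring breakpoints makes it lie between. *)
Lemma gap_breakpoint : A (e k0) -> A (e k0.+1) -> exists s, breakpoint phi e A g k0 s.
Proof.
move=> A0 A1; have k0sz' := ltnW k0sz.
have lt01 := e_lt (ltnSn k0) k0sz.
pose s := (g (e k0) - g (e k0.+1)) / (lambda (e k0.+1) - lambda (e k0)).
have sE : g (e k0) + s * lambda (e k0) = g (e k0.+1) + s * lambda (e k0.+1).
  have : s * (lambda (e k0.+1) - lambda (e k0)) = g (e k0) - g (e k0.+1).
    by rewrite /s divfK // gt_eqF // subr_gt0.
  lra.
have below i : (i < k0)%N -> A (e i) ->
    g (e i) + s * lambda (e i) < g (e k0) + s * lambda (e k0).
  move=> ik Ai; have kE : k0.-1.+1 = k0 by lia.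
  have [||s1 bp1] := @bp k0.-1; [by lia|by lia|].
  have [_ m1] : maximal A g (s1 *: phi) (e k0) by apply/bp1; right; rewrite kE.
  have le1 := m1 _ Ai; rewrite !pairingZl in le1.
  have : g (e k0.+1) + s1 * lambda (e k0.+1) < g (e k0) + s1 * lambda (e k0).
    rewrite -!pairingZl lt_neqAle m1 // andbT; apply/eqP => same.
    suff /bp1[] : maximal A g (s1 *: phi) (e k0.+1) by move=> /e_inj; lia.
    by split=> // w Aw; rewrite same; exact: m1.
  have := e_lt ik k0sz'; nra.
have above i : (k0.+1 < i)%N -> (i < sz)%N -> A (e i) ->
    g (e i) + s * lambda (e i) < g (e k0.+1) + s * lambda (e k0.+1).
  move=> ki isz Ai; have [||s1 bp1] := @bp k0.+1; [by lia|by lia|].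
  have [_ m1] : maximal A g (s1 *: phi) (e k0.+1) by apply/bp1; left.
  have le1 := m1 _ Ai; rewrite !pairingZl in le1.
  have : g (e k0) + s1 * lambda (e k0) < g (e k0.+1) + s1 * lambda (e k0.+1).
    rewrite -!pairingZl lt_neqAle m1 // andbT; apply/eqP => same.
    suff /bp1[] : maximal A g (s1 *: phi) (e k0) by move=> /e_inj; lia.
    by split=> // w Aw; rewrite same; exact: m1.
  have := e_lt ki isz; nra.
have m0 : maximal A g (s *: phi) (e k0).
  split=> // u; have [i isz <-] := e_surj u => Ai; rewrite !pairingZl.
  have [ik|ki|->//] := ltngtP i k0; first exact/ltW/below.
  have [ki'|ik'] := ltnP k0.+1 i; first by rewrite sE; exact/ltW/above.
  have -> : i = k0.+1 by lia.
  by rewrite sE.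
have m1 : maximal A g (s *: phi) (e k0.+1).
  by split=> // u /m0.2; rewrite !pairingZl sE.
exists s => u; split=> [um|[->|->]] //.
have [i isz ui] := e_surj u; rewrite -ui in um *.
have := um.2 _ A0; rewrite !pairingZl leNgt => /negP le.
have [ik|ki|->] := ltngtP i k0; [by case: le; exact: below um.1| |by left].
have [ki'|ik'] := ltnP k0.+1 i; first by case: le; rewrite sE; exact: above um.1.
by right; congr e; lia.
Qed.

(** An end of the gap absent from [A] cannot be an end of another edge, so it is the first or the
    last lattice point. Its corner is then absent from [A'] too, and the window shrinks by one to
    match the breakpoints; with both ends present, the gap supplies the breakpoint itself. *)
Lemma gap_exchange_free (A' : pred L) (g' : L -> R) (psi : V) :
  (forall psi' : V, two_maximal A g psi' -> two_maximal A' g' psi') ->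
  exchange_free (maximal A' g' psi).
Proof.
move=> two.
have conclude a b : (b < sz)%N ->
    (forall k, (a <= k < b)%N -> exists s, breakpoint phi e A g k s) ->
    (forall i, (i < sz)%N -> A' (e i) -> (a <= i <= b)%N) ->
    exchange_free (maximal A' g' psi).
  move=> bsz bpab A'ab.
  have /choice [S SP] k : exists s, (a <= k < b)%N -> breakpoint phi e A g k s.
    by have [/bpab[s]|] := boolP (a <= k < b)%N; [exists s|exists 0].
  apply: (breakpoint_exchange_free phi_order e_prec e_surj bsz _ A'ab (S := S)).
  apply: (breakpoint_count phi_order e_prec e_surj bsz _ _ A'ab) => [k kb|k l ak kl lb].
    apply/two/(breakpoint_two_maximal phi_order e_prec _ (SP k kb)); lia.
  by apply: (breakpoint_increasing phi_order e_prec kl _ (SP k _) (SP l _)); lia.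
(* With three lattice points the two ends of the gap cannot both be extreme. *)
have sz3 : (2 < sz)%N := leq_ltn_trans n2 (card_lattice_pt n d0).
have in_A i : (i < sz)%N -> i != k0 -> i != k0.+1 -> A (e i).
  move=> isz ik ik'; have [isz'|] := ltnP i.+1 sz.
    by have [s bps] := bp isz' ik; have [] : maximal A g (s *: phi) (e i) by apply/bps; left.
  move=> szi; have iE : i.-1.+1 = i by lia.
  have [||s bps] := @bp i.-1; [by lia|by lia|].
  by have [] : maximal A g (s *: phi) (e i) by apply/bps; right; rewrite iE.
have in_A0 : (0 < k0)%N -> A (e k0).
  move=> k00; have kE : k0.-1.+1 = k0 by lia.
  have [||s bps] := @bp k0.-1; [by lia|by lia|].
  by have [] : maximal A g (s *: phi) (e k0) by apply/bps; right; rewrite kE.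
have in_A1 : (k0.+2 < sz)%N -> A (e k0.+1).
  move=> k02; have [|s bps] := bp k02; first by lia.
  by have [] : maximal A g (s *: phi) (e k0.+1) by apply/bps; left.
have AE i v0 : e i = v0 -> (i < sz)%N -> ~~ A (e i) ->
    (forall j, (j < sz)%N -> j != i -> A (e j)) -> forall v, A v = (v != v0).
  move=> <- isz nAi Aj v; have [j jsz <-] := e_surj v.
  have [->|ji] := eqVneq j i; first by rewrite eqxx (negPf nAi).
  by rewrite Aj //; apply/esym; apply: contra ji => /eqP /e_inj ->.
have [A0|nA0] := boolP (A (e k0)); last first.
  have k00 : k0 = 0%N by apply/eqP; rewrite -leqn0 leqNgt (contra in_A0 nA0).
  have nA' : ~~ A' (e 0).
    apply: (@missing_corner R n d A g A' g' ord0) => //.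
      apply: prec_minimal_corner => v; have [j jsz <-] := e_surj v.
      by move=> /(precP _ _ phi_order) /(e_lt_inv phi_order e_prec jsz).
    apply: (AE 0%N) => //; [by lia|by rewrite -k00|].
    move=> j jsz j0; have [j1|j1] := eqVneq j k0.+1; last by apply: in_A => //; rewrite k00.
    by rewrite j1; apply: in_A1; rewrite k00.
  apply: (conclude 1%N sz.-1); first by lia.
    by move=> k kb; apply: bp; rewrite ?k00; lia.
  by move=> [|i] isz A'i; [rewrite A'i in nA'|lia].
have [A1|nA1] := boolP (A (e k0.+1)); last first.
  have k01 : k0.+2 = sz.
    by apply/eqP; rewrite eqn_leq k0sz leqNgt (contra in_A1 nA1).
  have nA' : ~~ A' (e k0.+1).
    apply: (@missing_corner R n d A g A' g' ord_max) => //.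
      apply: prec_maximal_corner => v; have [j jsz <-] := e_surj v.
      by move=> /(precP _ _ phi_order) /(e_lt_inv phi_order e_prec k0sz); lia.
    apply: (AE k0.+1) => // j jsz j1.
    by have [->//|j0] := eqVneq j k0; exact: in_A.
  apply: (conclude 0%N k0) => [|k kb|i isz A'i]; first by lia.
    by apply: bp; lia.
  have [iE|] := eqVneq i k0.+1; last by lia.
  by rewrite iE (negPf nA') in A'i.
apply: (conclude 0%N sz.-1) => [|k kb|i isz _]; [by lia| |by lia].
have [->|kk0] := eqVneq k k0; first exact: gap_breakpoint.
by apply: bp => //; lia.
Qed.

End Gap.

Unset Implicit Arguments.

Theorem proposition3p7 (R : realType) (n d : nat) (phi : 'rV[R]_n.+1)
    (hn : (2 <= n)%N) (hd : (1 <= d)%N) (hphi : order_functional d phi) :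
  exists Lam : seq {ffun 'I_((hypersurface_dim n d).-1) -> rat},
  forall chi : 'I_((hypersurface_dim n d).-1) -> 'rV[R]_n.+1,
    mikhalkin_position Lam phi chi ->
    ~ exists c : lattice_pt n d -> \bar R,
        [/\ tropical_polynomial c,
            singular_hypersurface c,
            forall i, hypersurface c (chi i) &
            exists wpr w : lattice_pt n d,
              consecutive [set: lattice_pt n d] wpr w /\
              dual_path c chi =
                path_of [set: lattice_pt n d] `\ segment (pt R wpr) (pt R w)].
Proof.
exists [::] => chi [M [_ _ chiM]] [c [c_poly [psi [_ [P [Pform tropP singP]]]] _]].
move: singP => [q [q0 Pq _]] [wpr [w [wpr_w pathE]]].
have [e [e_prec e_surj]] := lattice_enumeration hphi wpr.
have [k0 [k0sz wprE wE]] := consecutive_e hphi e_prec e_surj wpr_w.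
apply: (singular_zero_not_exchange_free hd Pform q0 Pq).
apply: (gap_exchange_free hphi hn hd e_prec e_surj (A := esupp c) (g := ecoef c) k0sz).
  move=> k ksz kk0; have vw := e_consecutive hphi e_prec e_surj ksz.
  have : dual_path c chi (segment (pt R (e k)) (pt R (e k.+1))).
    rewrite pathE; split; first by exists (e k), (e k.+1).
    move=> /(segment_consecutive_inj hphi vw wpr_w) [ek _]; case/eqP: kk0.
    by apply: (e_inj hphi e_prec (ltnW ksz) (ltnW k0sz)); rewrite ek wprE.
  (* The parameter is the factor of [phi] in [chi i]; the additive constant of the representative
     does not affect [maximal]. *)
  move=> /(dual_path_maximal hphi c_poly vw) [i iE]; exists (ratr (M i)) => u.
  by have [a chiE] := chiM i; rewrite -(maximal_shift _ _ _ a) -chiE.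
move=> psi' /(two_maximal_hypersurface c_poly); rewrite -tropP.
exact: tropicalization_two_maximal.
Qed.
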